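(* For any $N\ge 1$, any $f_1,\dots,f_N\in\mathbf{P}^{\log}_{\mathbb{Q}}$ and any $\omega_1(z),\dots,\omega_N(z)\in\{\frac{dz}{z},\frac{dz}{1-z}\}$, one can define a regularized iterated integral $I^{\mathrm{reg}}(f_1,\dots,f_N;\omega_1,\dots,\omega_N)\in\mathbb{R}$ (by the regularization procedure described in the context), and it has the following properties. 1. It satisfies the shuffle product of iterated integrals: for all $N,M\ge 1$, all $f_1,\dots,f_{N+M}\in\mathbf{P}^{\log}_{\mathbb{Q}}$ and all $\omega_1,\dots,\omega_{N+M}\in\{\frac{dz}{z},\frac{dz}{1-z}\}$, $$I^{\mathrm{reg}}(f_1,\dots,f_N;\omega_1,\dots,\omega_N)\cdot I^{\mathrm{reg}}(f_{N+1},\dots,f_{N+M};\omega_{N+1},\dots,\omega_{N+M})=\sum_{\sigma}I^{\mathrm{reg}}(f_{\sigma^{-1}(1)},\dots,f_{\sigma^{-1}(N+M)};\omega_{\sigma^{-1}(1)},\dots,\omega_{\sigma^{-1}(N+M)}),$$ where $\sigma$ runs over all permutations of $\{1,\dots,N+M\}$ with $\sigma(1)<\cdots<\sigma(N)$ and $\sigma(N+1)<\cdots<\sigma(N+M)$. 2. If the iterated integral $$I(f_1,\dots,f_N;\omega_1,\dots,\omega_N)=\int\cdots\int_{0<z_1<\cdots<z_N<1}f_1(z_1)\omega_1(z_1)\cdots f_N(z_N)\omega_N(z_N)$$ is convergent, then $I^{\mathrm{reg}}(f_1,\dots,f_N;\omega_1,\dots,\omega_N)=I(f_1,\dots,f_N;\omega_1,\dots,\omega_N)$.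 3. $I^{\mathrm{reg}}(f_1,\dots,f_N;\omega_1,\dots,\omega_N)$ always belongs to the algebra of multiple zeta values.
   Context: For integers $k_1,\dots,k_r\ge 1$ ($r\ge 1$), $\mathrm{Li}_{k_1,\dots,k_r}(z)=\sum_{0<n_1<\cdots<n_r}\frac{z^{n_r}}{n_1^{k_1}\cdots n_r^{k_r}}$ for $|z|<1$. $\mathbf{P}^{\log}_{\mathbb{Q}}$ denotes the $\mathbb{Q}$-algebra of functions on $0<z<1$ generated by $1$ and all $\mathrm{Li}_{k_1,\dots,k_r}(z)$, $\mathrm{Li}_{k_1,\dots,k_r}(1-z)$ ($r\ge1$, $k_1,\dots,k_r\ge 1$). A multiple zeta value is $\zeta(k_1,\dots,k_r)=\sum_{0<n_1<\cdots<n_r}\frac{1}{n_1^{k_1}\cdots n_r^{k_r}}$ with $r\ge1$, $k_1,\dots,k_{r-1}\ge 1$, $k_r\ge 2$. The algebra of multiple zeta values is the $\mathbb{Q}$-subalgebra of $\mathbb{R}$ generated by them; as a $\mathbb{Q}$-vector space it is spanned by $1$ and the multiple zeta values. Truncated polylogarithms. Given $k_1,\dots,k_r\ge1$, put $n=k_1+\cdots+k_r$ and $S=\{1,k_1+1,\dots,k_1+\cdots+k_{r-1}+1\}$. For $1\le i\le n$ let $\nu_i(t)=\frac{dt}{1-t}$, $\nu'_i(t)=\frac{dt}{t}$ if $i\in S$, and $\nu_i(t)=\frac{dt}{t}$, $\nu'_i(t)=\frac{dt}{1-t}$ if $i\notin S$. For $0<z<1$ one has $\mathrm{Li}_{k_1,\dots,k_r}(z)=\int_{0<t_1<\cdots<t_n<z}\nu_1(t_1)\cdots\nu_n(t_n)$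 and $\mathrm{Li}_{k_1,\dots,k_r}(1-z)=\int_{z<t_n<\cdots<t_1<1}\nu'_n(t_n)\cdots\nu'_1(t_1)$. For $\epsilon,\eta>0$ with $\epsilon+\eta<1$ and $\epsilon<z<1-\eta$, the truncation of $\mathrm{Li}_{k_1,\dots,k_r}(z)$ is $\int_{\epsilon<t_1<\cdots<t_n<z}\nu_1(t_1)\cdots\nu_n(t_n)$, and the truncation of $\mathrm{Li}_{k_1,\dots,k_r}(1-z)$ is $\int_{z<t_n<\cdots<t_1<1-\eta}\nu'_n(t_n)\cdots\nu'_1(t_1)$. Regularization procedure. Suppose first that each $f_i$ is a monic monomial (a finite, possibly empty, product) in the functions $\mathrm{Li}_{k_1,\dots,k_r}(z)$ and $\mathrm{Li}_{k_1,\dots,k_r}(1-z)$. Let $f_i^{(\epsilon,\eta)}$ be obtained from $f_i$ by replacing each factor with its truncation, and put $$I^{(\epsilon,\eta)}(f_1,\dots,f_N;\omega_1,\dots,\omega_N)=\int\cdots\int_{\epsilon<z_1<\cdots<z_N<1-\eta}f_1^{(\epsilon,\eta)}(z_1)\omega_1(z_1)\cdots f_N^{(\epsilon,\eta)}(z_N)\omega_N(z_N).$$ There is a unique polynomial $P$ in two variables such that, for some constant $A$, $$I^{(\epsilon,\eta)}(f_1,\dots,f_N;\omega_1,\dots,\omega_N)=P(\log\epsilon,\log\eta)+O\big((\epsilon+\eta)(|\log\epsilon|+|\log\eta|)^A\big)\qquad(\epsilon,\eta\to0^+),$$ and one sets $I^{\mathrm{reg}}(f_1,\dots,f_N;\omega_1,\dots,\omega_N)=P(0,0)$.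 For general $f_i\in\mathbf{P}^{\log}_{\mathbb{Q}}$, $I^{\mathrm{reg}}$ is defined by writing each $f_i$ as a $\mathbb{Q}$-linear combination of such monomials and extending $\mathbb{Q}$-multilinearly in $(f_1,\dots,f_N)$. *)

(* Defs.v *)
(* Analysis uses Stdlib's R with Coquelicot; finite index sets, permutations,
   rationals and polynomials come from MathComp, through the MathComp
   structures on R provided by Rstruct. *)
From Stdlib Require Export Reals.
From Coquelicot Require Export Coquelicot.
From mathcomp Require Export all_boot all_order all_algebra all_fingroup.
From mathcomp Require Export boolp classical_sets.
From mathcomp Require Export Rstruct.

Set Implicit Arguments.
Unset Strict Implicit.
Unset Printing Implicit Defensive.

Delimit Scope R_scope with coqR.
Delimit Scope ring_scope with R.

Local Open Scope ring_scope.
Local Open Scope R_scope.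
Local Open Scope nat_scope.

Definition index := {ks : seq nat | (ks != [::]) && all (fun k => 0 < k) ks}.

(* mhsum [:: k_1; ...; k_s] n is the sum over 0 < n_1 < ... < n_s < n of
   1 / (n_1^k_1 ... n_s^k_s); it is 1 for s = 0. *)
Definition mhsum (ks : seq nat) : nat -> R :=
  foldl (fun (H : nat -> R) k n =>
           (\sum_(1 <= m < n) (H m / INR m ^ k)%coqR)%R)
        (fun=> 1%coqR) ks.

(* The part of the series with n_r = n. *)
Definition mterm (ks : seq nat) (n : nat) : R :=
  (mhsum (take (size ks).-1 ks) n / INR n ^ last 0%N ks)%coqR.

Definition Li (ks : seq nat) (z : R) : R :=
  Series (fun n => mterm ks n.+1 * z ^ n.+1)%coqR.

Definition zeta (ks : seq nat) : R := Series (fun n => mterm ks n.+1).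

Inductive mzv_algebra : R -> Prop :=
| mzv_rat (q : rat) : mzv_algebra (ratr q)
| mzv_zeta (k : index) : 1 < last 0 (val k) -> mzv_algebra (zeta (val k))
| mzv_add x y : mzv_algebra x -> mzv_algebra y -> mzv_algebra (x + y)%coqR
| mzv_mul x y : mzv_algebra x -> mzv_algebra y -> mzv_algebra (x * y)%coqR.

(* Functions on 0 < z < 1 are total functions on R whose values outside that
   interval are irrelevant, whence the last constructor. *)
Inductive Plog : (R -> R) -> Prop :=
| Plog_rat (q : rat) : Plog (fun=> ratr q)
| Plog_Li (k : index) : Plog (fun z => Li (val k) z)
| Plog_Li1 (k : index) : Plog (fun z => Li (val k) (1 - z)%coqR)
| Plog_add f g : Plog f -> Plog g -> Plog (fun z => f z + g z)%coqR
| Plog_mul f g : Plog f -> Plog g -> Plog (fun z => f z * g z)%coqR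
| Plog_ext f g : (forall z, (0 < z < 1)%coqR -> f z = g z) -> Plog f -> Plog g.

(* dz/z and dz/(1-z) *)
Inductive form := Form0 | Form1.

Definition density (w : form) (z : R) : R :=
  match w with Form0 => (/ z)%coqR | Form1 => (/ (1 - z))%coqR end.

(* iterint a b [:: g_1; ...; g_n] is the integral of g_1(t_1) ... g_n(t_n) over
   a < t_1 < ... < t_n < b, the innermost integration being over t_1. *)
Definition iterint (a b : R) (gs : seq (R -> R)) : R :=
  foldl (fun (F : R -> R) g z => RInt (fun t => F t * g t)%coqR a z)
        (fun=> 1%coqR) gs b.

Definition starts (ks : seq nat) : seq nat :=
  [seq (sumn (take j ks)).+1 | j <- iota 0 (size ks)].

Definition nu (ks : seq nat) (i : nat) : form :=
  if i \in starts ks then Form1 else Form0.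

Definition nu' (ks : seq nat) (i : nat) : form :=
  if i \in starts ks then Form0 else Form1.

(* GenLi k is Li_k(z) and GenLi1 k is Li_k(1 - z). *)
Inductive generator := GenLi of index | GenLi1 of index.

Definition gen_fun (g : generator) (z : R) : R :=
  match g with
  | GenLi k => Li (val k) z
  | GenLi1 k => Li (val k) (1 - z)%coqR
  end.

Definition gen_trunc (eps eta : R) (g : generator) (z : R) : R :=
  match g with
  | GenLi k =>
      iterint eps z
        [seq density (nu (val k) i) | i <- iota 1 (sumn (val k))]
  | GenLi1 k =>
      iterint z (1 - eta)%coqR
        [seq density (nu' (val k) i) | i <- rev (iota 1 (sumn (val k)))]
  end.

Definition monomial := seq generator.

Definition mono_fun (m : monomial) (z : R) : R :=
  (\prod_(g <- m) gen_fun g z)%R.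

Definition mono_trunc (eps eta : R) (m : monomial) (z : R) : R :=
  (\prod_(g <- m) gen_trunc eps eta g z)%R.

Section Regularization.
Variable N : nat.
Implicit Types (f : 'I_N -> R -> R) (om : 'I_N -> form).

Definition Icut (eps eta : R) f om : R :=
  iterint eps (1 - eta)%coqR
    [seq (fun z => f i z * density (om i) z)%coqR | i <- enum 'I_N].

Definition Icut_mono (eps eta : R) (m : 'I_N -> monomial) om : R :=
  Icut eps eta (fun i => mono_trunc eps eta (m i)) om.

Definition log_expansion (m : 'I_N -> monomial) om (P : {poly {poly R}}) :
    Prop :=
  exists A C delta : R, (0 < delta)%coqR /\
    forall eps eta : R, (0 < eps < delta)%coqR -> (0 < eta < delta)%coqR ->
      (Rabs (Icut_mono eps eta m om - (P.[(ln eps)%:P].[ln eta])%R)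
       <= C * ((eps + eta) * Rpower (Rabs (ln eps) + Rabs (ln eta)) A))%coqR.

Definition Ireg_mono (m : 'I_N -> monomial) om : R :=
  ((xget 0 (log_expansion m om : set {poly {poly R}})).[0%:P].[0])%R.

(* v is obtained by writing each f_i as sum_(j < K) c_ij m_ij on 0 < z < 1 and
   expanding multilinearly; a common number K of terms can always be reached
   by padding with zero coefficients. *)
Definition Ireg_value f om (v : R) : Prop :=
  exists (K : nat) (c : 'I_N -> 'I_K -> rat) (m : 'I_N -> 'I_K -> monomial),
    (forall i z, (0 < z < 1)%coqR ->
       f i z = (\sum_(j < K) ratr (c i j) * mono_fun (m i j) z)%R) /\
    v = (\sum_(J : {ffun 'I_N -> 'I_K})
           (\prod_(i < N) ratr (c i (J i)))
           * Ireg_mono (fun i => m i (J i)) om)%R.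

Definition Ireg f om : R := xget 0%coqR (Ireg_value f om : set R).

(* The integral over 0 < z_1 < ... < z_N < 1 converges to L as an improper
   integral; this covers absolute convergence. *)
Definition Iconverges f om (L : R) : Prop :=
  filterlim (fun p : R * R => Icut p.1 p.2 f om)
    (filter_prod (at_right 0%coqR) (at_right 0%coqR)) (locally L).

End Regularization.

Definition is_shuffle (N M : nat) (s : {perm 'I_(N + M)}) : bool :=
  [forall i : 'I_N, forall j : 'I_N,
     (i < j) ==> (s (lshift M i) < s (lshift M j))] &&
  [forall i : 'I_M, forall j : 'I_M,
     (i < j) ==> (s (rshift N i) < s (rshift N j))].

(* Main.v *)
Require Import Defs.
From mathcomp Require Import polyXY.
From Stdlib Require Import Lra.

Set Implicit Arguments.
Unset Strict Implicit.
Unset Printing Implicit Defensive.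
Import GRing.Theory.
Local Open Scope R_scope.

(** Throughout, eps and eta are cut-offs in (0, 1/4), ell = |log eps| + |log eta|, and an error
    is called small when it is O((eps + eta) ell^n) for some n, uniformly in the variable z of
    [eps, 1 - eta].

    The regularized integral depends only on the functions f_i because truncating a
    polylogarithm is a small change: every form dz/z or dz/(1-z) has mass at most ell on
    [eps, 1 - eta], so the error at 0 (or at 1) propagates through iterated integration with a
    loss of powers of ell only ([wint_Li_word], [gen_trunc_small], [iterint_small]).  Hence the
    truncated integral of a choice of monomials has the same expansion as the integral over
    eps < z_1 < ... < z_N < 1 - eta of the exact functions, which is multilinear in them
    ([iterint_multilinear]).  As expansions are unique ([log_expands_unique]), the value of the
    regularized integral is P(0,0), where P(log eps, log eta) is the expansion of the cut
    integral of f_1, ..., f_N, whatever the expressions chosen for the f_i ([IregE]).  From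
    this the shuffle product and the agreement with convergent integrals follow: cut integrals
    satisfy the shuffle product exactly ([itr_shuffle], [shuffle_perms]), P maps to P(0,0) by a
    ring morphism, and P is constant when the cut integral converges.

    It remains to find P, with P(0,0) in the algebra of multiple zeta values.  Truncated
    polylogarithms are iterated integrals, from eps to z or from z to 1 - eta, of words in the
    two forms.  Path composition ([itr_path]) expresses the second kind through the first, with
    coefficients that are integrals of words from eps to 1 - eta ([zspan_upper]).  By the
    shuffle product, the functions of z so obtained form an algebra, closed under integration
    from eps against the two forms ([zspan_mul], [zspan_int]); evaluating at z = 1 - eta, the
    truncated integrals become polynomials in the integrals of words from eps to 1 - eta.  For
    these ([mzv_expandable_word]): a word starting with dt/(1-t) and ending with dt/t gives a
    multiple zeta value up to a small error; shuffling with the single letter dt/(1-t), whose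
    integral is - log eta up to a small error, removes the final letters dt/(1-t); and the
    reflection t -> 1 - t exchanges this with the initial letters dt/t.

    One caution on uniqueness: (eps + eta) ell^n does not tend to 0 when eps and eta tend to 0
    independently, but it does along each ray eps = exp(c) eta, and a polynomial in the two
    logarithms which tends to 0 along all these rays vanishes ([eval2_ray0]). *)

(** * Iterated integrals of words of continuous functions *)

(** Equalities of derivatives and integrals live in a module structure on R, which hides from
    ring that R is the real numbers. *)
Ltac eqR := match goal with |- @eq _ ?x ?y => change (@eq R x y) end.

(** Letters carry the continuity of their function, so that statements on words need no side
    conditions. *)
Record cfun := Cfun { cf :> R -> R;
  cf_cont : forall t, 0 < t < 1 -> continuous cf t }.

Lemma cfun_eq (g h : cfun) : (forall t, g t = h t) -> g = h.
Proof.
case: g h => [g Hg] [h Hh] /= gh.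
have e : g = h by apply: boolp.funext.
subst h; congr Cfun; exact: Prop_irrelevance.
Qed.

(** The outermost letter comes first, contrary to [iterint]: induction on the word then follows
    the last integration. *)
Fixpoint itr (a : R) (w : seq cfun) (z : R) : R :=
  match w with
  | [::] => 1
  | g :: w' => RInt (fun t => itr a w' t * g t) a z
  end.

Lemma iterint_itr a b (w : seq cfun) :
  iterint a b (map cf w) = itr a (rev w) b.
Proof.
elim/last_ind: w b => [//|w g IH] b.
rewrite rev_rcons map_rcons /= /iterint foldl_rcons.
by congr RInt; apply: boolp.funext => t; rewrite -IH.
Qed.

Lemma between01 a z t : 0 < a < 1 -> 0 < z < 1 -> Rmin a z <= t <= Rmax a z ->
  0 < t < 1.
Proof. rewrite /Rmin /Rmax; case: Rle_dec; lra. Qed.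

Lemma near01 z (P : R -> Prop) : 0 < z < 1 -> (forall t, 0 < t < 1 -> P t) ->
  locally z P.
Proof.
move=> Hz HP.
have Hd : 0 < Rmin z (1 - z) by apply: Rmin_glb_lt; lra.
exists (mkposreal _ Hd) => t Ht; apply: HP.
have {Ht} : Rabs (t - z) < Rmin z (1 - z) := Ht.
rewrite /Rmin; case: Rle_dec => ? /Rabs_def2 [? ?]; lra.
Qed.

Lemma RInt_cont01 (h : R -> R) a z : (forall t, 0 < t < 1 -> continuous h t) ->
  0 < a < 1 -> 0 < z < 1 -> ex_RInt h a z.
Proof.
move=> ch Ha Hz; apply: ex_RInt_continuous => t Ht.
by apply: ch; apply: between01 Ht.
Qed.

Lemma RInt_deriv01 (h : R -> R) a z : (forall t, 0 < t < 1 -> continuous h t) ->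
  0 < a < 1 -> 0 < z < 1 -> is_derive (fun x => RInt h a x) z (h z).
Proof.
move=> ch Ha Hz; apply: (is_derive_RInt h _ a); last exact: ch.
apply: near01 => // t Ht; apply: RInt_correct; exact: RInt_cont01.
Qed.

Lemma itr_cont a w z : 0 < a < 1 -> 0 < z < 1 -> continuous (itr a w) z.
Proof.
move=> Ha; elim: w z => [|g w IH] z Hz /=; first exact: continuous_const.
apply: ex_derive_continuous; eexists.
apply: (RInt_deriv01 (h := fun t => itr a w t * g t)) => // t Ht.
by apply: (continuous_mult (itr a w) g); [exact: IH | exact: cf_cont].
Qed.

Lemma itr_deriv a g w z : 0 < a < 1 -> 0 < z < 1 ->
  is_derive (itr a (g :: w)) z (itr a w z * g z).
Proof.
move=> Ha Hz /=.
apply: (RInt_deriv01 (h := fun t => itr a w t * g t)) => // t Ht.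
by apply: (continuous_mult (itr a w) g); [exact: itr_cont | exact: cf_cont].
Qed.

Lemma itr_diag a g w : itr a (g :: w) a = 0.
Proof. by rewrite /= RInt_point. Qed.

(** The uniqueness principle behind the identities between iterated integrals: both sides agree
    at one point, and by induction they have the same derivative. *)
Lemma eq_of_deriv (f g d : R -> R) a z :
  (forall t, 0 < t < 1 -> is_derive f t (d t)) ->
  (forall t, 0 < t < 1 -> is_derive g t (d t)) ->
  f a = g a -> 0 < a < 1 -> 0 < z < 1 -> f z = g z.
Proof.
move=> df dg fga Ha Hz.
have H t : 0 < t < 1 -> is_derive (fun x => f x - g x) t ((fun=> 0) t).
  move=> Ht; have := is_derive_minus f g t _ _ (df t Ht) (dg t Ht).
  by rewrite /minus plus_opp_r.
have [||c [_ Hc]] := MVT_gen (fun x => f x - g x) a z (fun=> 0).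
- by move=> x Hx; apply: H; apply: (between01 Ha Hz); lra.
- move=> x Hx; apply: derivable_continuous_pt; eexists.
  by apply/is_derive_Reals; apply: H; apply: (between01 Ha Hz).
lra.
Qed.

(** * The shuffle product *)

Section Shuffle.
Variable T : Type.
Fixpoint shuffle (u : seq T) : seq T -> seq (seq T) :=
  match u with
  | [::] => fun v => [:: v]
  | x :: u' => fix shx (v : seq T) :=
      match v with
      | [::] => [:: x :: u']
      | y :: v' => map (cons x) (shuffle u' (y :: v')) ++ map (cons y) (shx v')
      end
  end.

Lemma shuffle_cons x u y v : shuffle (x :: u) (y :: v) =
  map (cons x) (shuffle u (y :: v)) ++ map (cons y) (shuffle (x :: u) v).
Proof. by []. Qed.
Lemma shuffle0r u : shuffle u [::] = [:: u].
Proof. by case: u. Qed.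
End Shuffle.

(** Sums over lists which compute, for functions of a real variable; [sumR_big] relates them to
    bigops. *)
Definition sumR (T : Type) (F : T -> R) (l : seq T) : R :=
  foldr (fun x acc => F x + acc) 0 l.

Lemma sumR_cons T (F : T -> R) x l : sumR F (x :: l) = F x + sumR F l.
Proof. by []. Qed.

Lemma sumR_cat T (F : T -> R) l1 l2 : sumR F (l1 ++ l2) = sumR F l1 + sumR F l2.
Proof. elim: l1 => [|x l IH] /=; rewrite ?IH /=; lra. Qed.

Lemma sumR_map T U (h : U -> T) (F : T -> R) l :
  sumR F (map h l) = sumR (fun x => F (h x)) l.
Proof. by elim: l => [|x l IH] //=; rewrite IH. Qed.

Lemma sumR_big T (F : T -> R) l : sumR F l = (\sum_(x <- l) F x)%R.
Proof. by elim: l => [|x l IH]; rewrite ?big_nil ?big_cons //= IH. Qed.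

Lemma sumR_itr_deriv (T : Type) (phi : T -> cfun) a x (l : seq (seq T)) z :
  0 < a < 1 -> 0 < z < 1 ->
  is_derive (fun z => sumR (fun w => itr a (map phi w) z) (map (cons x) l)) z
    (sumR (fun w => itr a (map phi w) z) l * phi x z).
Proof.
move=> Ha Hz; elim: l => [|w l IH].
  by rewrite /= Rmult_0_l; apply: is_derive_const.
rewrite [sumR _ (w :: l)]/= Rmult_plus_distr_r.
apply: (is_derive_plus (itr a (map phi (x :: w)))) IH.
exact: (@itr_deriv a (phi x) (map phi w)).
Qed.

(** The derivative of the product with respect to its upper limit strips the outermost letter of
    one factor or of the other, as in the recursive definition of the shuffle. *)
Theorem itr_shuffle (T : Type) (phi : T -> cfun) a u v z :
  0 < a < 1 -> 0 < z < 1 ->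
  itr a (map phi u) z * itr a (map phi v) z
  = sumR (fun w => itr a (map phi w) z) (shuffle u v).
Proof.
move=> Ha; elim: u v z => [|x u IHu] v z Hz; first by rewrite /=; lra.
elim: v z Hz => [|y v IHv] z Hz; first by rewrite shuffle0r [sumR _ _]/= /=; lra.
apply: (@eq_of_deriv (fun z => itr a (map phi (x :: u)) z * itr a (map phi (y :: v)) z)
  (fun z => sumR (fun w => itr a (map phi w) z) (shuffle (x :: u) (y :: v)))
  (fun t => itr a (map phi u) t * phi x t * itr a (map phi (y :: v)) t
   + itr a (map phi (x :: u)) t * (itr a (map phi v) t * phi y t)) a z) => //.
- move=> t Ht; apply: (is_derive_mult (itr a (map phi (x :: u))) (itr a (map phi (y :: v)))).
  + exact: (@itr_deriv a (phi x) (map phi u)).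
  + exact: (@itr_deriv a (phi y) (map phi v)).
  + by move=> *; apply: Rmult_comm.
- move=> t Ht.
  apply: (is_derive_ext (fun z =>
       sumR (fun w => itr a (map phi w) z) (map (cons x) (shuffle u (y :: v)))
       + sumR (fun w => itr a (map phi w) z) (map (cons y) (shuffle (x :: u) v)))).
    by move=> s; rewrite shuffle_cons sumR_cat.
  have -> : itr a (map phi u) t * phi x t * itr a (map phi (y :: v)) t
   + itr a (map phi (x :: u)) t * (itr a (map phi v) t * phi y t)
    = sumR (fun w => itr a (map phi w) t) (shuffle u (y :: v)) * phi x t
     + sumR (fun w => itr a (map phi w) t) (shuffle (x :: u) v) * phi y t.
    rewrite -IHu // -IHv //; ring.
  by apply: is_derive_plus; apply: sumR_itr_deriv.
- rewrite shuffle_cons sumR_cat !sumR_map map_cons itr_diag.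
  have H0 s l : sumR (fun w => itr a (map phi (s :: w)) a) l = 0.
    by elim: l => [//|w l IH]; rewrite sumR_cons map_cons IH itr_diag Rplus_0_l.
  by rewrite !H0 Rmult_0_l Rplus_0_l.
Qed.

(** * Path composition *)

(** The ways to cut a word in two, except the one with an empty second part. *)
Fixpoint psplits (T : Type) (w : seq T) : seq (seq T * seq T) :=
  match w with
  | [::] => [::]
  | g :: w' => ([::], g :: w') :: map (fun p => (g :: p.1, p.2)) (psplits w')
  end.

Lemma sumR_deriv (T : Type) (F : T -> R -> R) (d : T -> R) l z :
  (forall x, is_derive (F x) z (d x)) ->
  is_derive (fun z => sumR (F^~ z) l) z (sumR d l).
Proof.
move=> H; elim: l => [|x l IH] /=; first exact: is_derive_const.
exact: (is_derive_plus (F x)).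
Qed.

Lemma sumRZ T k (F : T -> R) l : sumR (fun x => k * F x) l = k * sumR F l.
Proof. by elim: l => [|x l IH] /=; rewrite ?IH; ring. Qed.

Lemma eq_sumR T (F G : T -> R) l : (forall x, F x = G x) -> sumR F l = sumR G l.
Proof. by move=> H; elim: l => [|x l IH] //=; rewrite H IH. Qed.

(** The integration domain from a to z is cut according to the number of variables beyond c. *)
Theorem itr_path a c w z : 0 < a < 1 -> 0 < c < 1 -> 0 < z < 1 ->
  itr a w z = itr c w z + sumR (fun p => itr c p.1 z * itr a p.2 c) (psplits w).
Proof.
move=> Ha Hc; elim: w z => [|g w IH] z Hz; first by rewrite /=; ring.
apply: (@eq_of_deriv (itr a (g :: w)) (fun z => itr c (g :: w) z + 
   sumR (fun p => itr c p.1 z * itr a p.2 c) (psplits (g :: w)))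
  (fun t => itr a w t * g t) c z) => //.
- move=> t Ht; exact: itr_deriv.
- move=> t Ht; rewrite IH // Rmult_plus_distr_r.
  apply: (is_derive_plus (itr c (g :: w))); first exact: itr_deriv.
  rewrite [psplits _]/=.
  apply: (is_derive_ext (fun z => itr a (g :: w) c +
     sumR (fun p => itr c (g :: p.1) z * itr a p.2 c) (psplits w))).
    by move=> s; rewrite sumR_cons sumR_map [in RHS]/= Rmult_1_l.
  rewrite -[X in is_derive _ _ X]Rplus_0_l.
  apply: is_derive_plus; first exact: is_derive_const.
  rewrite Rmult_comm -sumRZ.
  apply: (sumR_deriv (F := fun p z => itr c (g :: p.1) z * itr a p.2 c)) => p.
  have -> : g t * (itr c p.1 t * itr a p.2 c) =
    (itr c p.1 t * g t) * itr a p.2 c + itr c (g :: p.1) t * 0 by ring.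
  apply: (is_derive_mult (itr c (g :: p.1)) (fun=> itr a p.2 c)).
  + exact: itr_deriv.
  + exact: is_derive_const.
  + by move=> *; apply: Rmult_comm.
- rewrite [psplits _]/= sumR_cons sumR_map itr_diag Rplus_0_l [itr c [::] c]/= Rmult_1_l.
  rewrite (@eq_sumR _ _ (fun=> 0 * 0)) ?sumRZ; first by rewrite Rmult_0_l Rplus_0_r.
  by move=> p; rewrite itr_diag !Rmult_0_l.
Qed.

(** * Reflection *)

(** The derivative of an iterated integral with respect to its lower limit: the innermost letter,
    which is the last one, is stripped. *)
Definition lowd (b : R) (w : seq cfun) (c : R) : R :=
  if w is x :: s then - last x s c * itr c (belast x s) b else 0.

Lemma lowd_rcons b u g c : lowd b (rcons u g) c = - g c * itr c u b.
Proof. by case: u => [|x u] //=; rewrite last_rcons belast_rcons. Qed.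

(** By the product rule, the sum telescopes: the lower derivative of a term in c cancels against
    the upper derivative of the preceding one. *)
Lemma lowd_psplits a b c u v : 0 < a < 1 -> 0 < c < 1 ->
  (forall u', (size u' < size u + size v)%N ->
     is_derive (fun c => itr c u' b) c (lowd b u' c)) ->
  is_derive (fun c => sumR (fun p => itr c (u ++ p.1) b * itr a p.2 c) (psplits v)) c
    (lowd b u c * itr a v c - lowd b (u ++ v) c).
Proof.
move=> Ha Hc; elim: v u => [|g v IH] u Hu.
  rewrite cats0 [itr _ _ _]/= Rmult_1_r Rminus_diag /=; exact: is_derive_const.
apply: (is_derive_ext (fun c => itr c u b * itr a (g :: v) c +
   sumR (fun p => itr c (rcons u g ++ p.1) b * itr a p.2 c) (psplits v))).
  move=> t; rewrite [psplits (_ :: _)]/= sumR_cons sumR_map cats0.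
  by congr Rplus; apply: eq_sumR => p; rewrite /= cat_rcons.
have -> : lowd b u c * itr a (g :: v) c - lowd b (u ++ g :: v) c
  = (lowd b u c * itr a (g :: v) c + itr c u b * (itr a v c * g c))
   + (lowd b (rcons u g) c * itr a v c - lowd b (rcons u g ++ v) c).
  by rewrite lowd_rcons cat_rcons; ring.
apply: is_derive_plus.
  apply: (is_derive_mult (fun c => itr c u b)).
  + by apply: Hu => /=; rewrite addnS ltnS leq_addr.
  + exact: itr_deriv.
  + by move=> *; apply: Rmult_comm.
by apply: IH => u' Hu'; apply: Hu; move: Hu'; rewrite size_rcons addSnnS.
Qed.

(** Path composition writes the integral from c through integrals from c of shorter words and
    integrals up to c; no differentiation under the integral sign is needed. *)
Theorem itr_lower_deriv b w c : 0 < b < 1 -> 0 < c < 1 ->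
  is_derive (fun c => itr c w b) c (lowd b w c).
Proof.
move=> Hb Hc; have [n] := ubnP (size w); elim: n w => // n IH w Hw.
apply: (is_derive_ext_loc (fun c' => itr c w b -
   sumR (fun p => itr c' ([::] ++ p.1) b * itr c p.2 c') (psplits w))).
  by apply: near01 => // t Ht; rewrite /= (itr_path w Hc Ht Hb); eqR; ring.
have -> : lowd b w c = 0 - (lowd b [::] c * itr c w c - lowd b ([::] ++ w) c).
  by rewrite /=; ring.
apply: is_derive_minus; first exact: is_derive_const.
by apply: lowd_psplits => // u' Hu'; apply: IH; exact: leq_trans Hu' _.
Qed.

Lemma refl_cont (g : cfun) t : 0 < t < 1 -> continuous (fun t => g (1 - t)) t.
Proof.
move=> Ht; apply: (continuous_comp (fun t => 1 - t)).
  apply: (continuous_minus (fun=> 1)); [exact: continuous_const | exact: continuous_id].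
by apply: cf_cont; lra.
Qed.

Definition refl (g : cfun) : cfun := Cfun (@refl_cont g).

(** The substitution t -> 1 - t reverses the order of the variables.  The upper derivative of one
    side is the lower derivative of the other. *)
Theorem itr_reflect a w b : 0 < a < 1 -> 0 < b < 1 ->
  itr a w b = itr (1 - b) (rev (map refl w)) (1 - a).
Proof.
move=> Ha; elim: w b => [//|g w IH] b Hb.
apply: (@eq_of_deriv (itr a (g :: w)) (fun b => itr (1 - b) (rev (map refl (g :: w))) (1 - a))
   (fun t => itr a w t * g t) a b) => //.
- by move=> t Ht; apply: itr_deriv.
- move=> t Ht; rewrite map_cons rev_cons.
  have -> : itr a w t * g t = -1 * lowd (1 - a) (rcons (rev (map refl w)) (refl g)) (1 - t).
    rewrite lowd_rcons IH // /=.
    rewrite (_ : 1 - (1 - t) = t). ring. ring.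
  apply: (is_derive_comp (fun c => itr c _ (1 - a)) (fun b => 1 - b)).
    by apply: itr_lower_deriv; lra.
  have -> : -1 = 0 - 1 by ring.
  by apply: is_derive_minus; [exact: is_derive_const | exact: is_derive_id].
- rewrite map_cons rev_cons itr_diag; case: (rev _) => [|x s] //=;
  by rewrite RInt_point.
Qed.

(** * Polylogarithm series *)

Lemma INR_gt0 n : 0 < INR n.+1.
Proof. by apply: lt_0_INR; apply/ltP. Qed.
#[local] Hint Resolve INR_gt0 : core.

Lemma mhsum_rcons ks k n : mhsum (rcons ks k) n =
  (\sum_(1 <= m < n) (mhsum ks m / INR m ^ k)%coqR)%R.
Proof. by rewrite /mhsum foldl_rcons. Qed.

Lemma mhsum_rcons1 ks k : mhsum (rcons ks k) 1 = 0.
Proof. by rewrite mhsum_rcons big_geq. Qed.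

Lemma mhsum_rconsS ks k n : mhsum (rcons ks k) n.+2 =
  mhsum (rcons ks k) n.+1 + mhsum ks n.+1 / INR n.+1 ^ k.
Proof. by rewrite !mhsum_rcons big_nat_recr. Qed.

(** The coefficient of z^(n+1) in Li; the shift avoids the vanishing constant term. *)
Definition Li_coef (ks : seq nat) (n : nat) : R := mterm ks n.+1.

Lemma Li_coef_rcons ks k n : Li_coef (rcons ks k) n = mhsum ks n.+1 / INR n.+1 ^ k.
Proof.
by rewrite /Li_coef /mterm size_rcons last_rcons -cats1 take_size_cat.
Qed.

Lemma mhsum_bound ks n : 0 <= mhsum ks n.+1 <= INR n.+1 ^ size ks.
Proof.
elim/last_ind: ks n => [|ks k IH] n; first by rewrite /mhsum /=; lra.
rewrite size_rcons; elim: n => [|n IHn].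
  by rewrite mhsum_rcons1; split; [lra | apply: pow_le; apply: pos_INR].
rewrite mhsum_rconsS; have [h0 h1] := IH n.
have hk : 0 < / INR n.+1 ^ k <= 1.
  split; first by apply: Rinv_0_lt_compat; apply: pow_lt.
  rewrite -Rinv_1; apply: Rinv_le_contravar; first lra.
  by apply: pow_R1_Rle; rewrite S_INR; have := pos_INR n; lra.
have h2 : INR n.+1 ^ (size ks) <= INR n.+2 ^ (size ks).
  by apply: pow_incr; split; [apply: pos_INR | rewrite (S_INR n.+1); lra].
have h3 : INR n.+1 ^ (size ks).+1 <= INR n.+1 * INR n.+2 ^ (size ks).
  by rewrite -tech_pow_Rmult; apply: Rmult_le_compat_l => //; apply: pos_INR.
have h4 : 0 <= mhsum ks n.+1 / INR n.+1 ^ k <= INR n.+1 ^ (size ks).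
  rewrite /Rdiv; split; first by apply: Rmult_le_pos; lra.
  by rewrite -[X in _ <= X]Rmult_1_r; apply: Rmult_le_compat; lra.
rewrite -[INR n.+2 ^ _]tech_pow_Rmult [INR n.+2 in X in _ <= X * _]S_INR; lra.
Qed.

Lemma Li_coef_ge0 ks k n : 0 <= Li_coef (rcons ks k) n.
Proof.
rewrite Li_coef_rcons; have [h _] := mhsum_bound ks n.
by apply: Rmult_le_pos => //; apply/Rlt_le/Rinv_0_lt_compat/pow_lt.
Qed.

Lemma Li_coef_bound ks k n : Li_coef (rcons ks k) n <= mhsum ks n.+1.
Proof.
rewrite Li_coef_rcons; have [h _] := mhsum_bound ks n.
rewrite -[X in _ <= X]Rmult_1_r; apply: Rmult_le_compat_l => //.
rewrite -Rinv_1; apply: Rinv_le_contravar; first lra.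
by apply: pow_R1_Rle; rewrite S_INR; have := pos_INR n; lra.
Qed.

Lemma CV_radius_le (a b : nat -> R) : (forall n, Rabs (b n) <= Rabs (a n)) ->
  Rbar_le (CV_radius a) (CV_radius b).
Proof.
move=> H; have [_ la] := CV_radius_bounded a; have [ub _] := CV_radius_bounded b.
apply: la => r [M HM]; apply: ub; exists M => n.
apply: Rle_trans (HM n); rewrite !Rabs_mult.
by apply: Rmult_le_compat_r => //; apply: Rabs_pos.
Qed.

(** The coefficients (n+1)^r arise from those of the geometric series by applying r times
    the operator (z f)', which preserves the radius of convergence. *)
Lemma CV_radius_pow r : Rbar_le 1 (CV_radius (fun n => INR n.+1 ^ r)).
Proof.
elim: r => [|r IH].
  have [ub _] := CV_radius_bounded (fun n => INR n.+1 ^ 0).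
  by apply: ub; exists 1 => n; rewrite pow1 /= Rmult_1_l Rabs_R1; lra.
rewrite (@CV_radius_ext _ (PS_derive (PS_incr_1 (fun n => INR n.+1 ^ r)))).
  by rewrite CV_radius_derive CV_radius_incr_1.
by move=> n; rewrite /PS_derive /PS_incr_1 tech_pow_Rmult.
Qed.

Lemma CV_radius_mhsum ks : Rbar_le 1 (CV_radius (fun n => mhsum ks n.+1)).
Proof.
apply: Rbar_le_trans (CV_radius_pow (size ks)) _; apply: CV_radius_le => n.
have [h0 h1] := mhsum_bound ks n.
by rewrite !Rabs_pos_eq //; lra.
Qed.

Lemma CV_radius_Li_coef ks k : Rbar_le 1 (CV_radius (Li_coef (rcons ks k))).
Proof.
apply: Rbar_le_trans (CV_radius_mhsum ks) _; apply: CV_radius_le => n.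
have [h0 h1] := mhsum_bound ks n; have := Li_coef_ge0 ks k n; have := Li_coef_bound ks k n.
by move=> *; rewrite !Rabs_pos_eq.
Qed.

Lemma in_radius a z : Rbar_le 1 (CV_radius a) -> Rabs z < 1 ->
  Rbar_lt (Rabs z) (CV_radius a).
Proof. by move=> H1 H2; apply: Rbar_lt_le_trans H1. Qed.

Lemma Li_PSeries ks z : Li ks z = PSeries (PS_incr_1 (Li_coef ks)) z.
Proof.
rewrite PSeries_incr_1 /PSeries -Series_scal_l; apply: Series_ext => n.
by rewrite -/(Li_coef ks n) /=; ring.
Qed.

(** With the value 1 at the empty index, where [Li] is z/(1-z) instead, the differential equations
    of polylogarithms hold for all indices. *)
Definition LiOne (ks : seq nat) (z : R) : R := if ks is [::] then 1 else Li ks z.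

Lemma LiOne_rcons ks k : LiOne (rcons ks k) = Li (rcons ks k).
Proof. by case: ks. Qed.

Lemma Li_derivable ks k z : Rabs z < 1 ->
  is_derive (Li (rcons ks k)) z (PSeries (fun n => INR n.+1 * Li_coef (rcons ks k) n) z).
Proof.
move=> Hz; apply: (is_derive_ext (PSeries (PS_incr_1 (Li_coef (rcons ks k))))).
  by move=> t; rewrite Li_PSeries.
apply: is_derive_PSeries; apply: in_radius => //.
rewrite CV_radius_incr_1; exact: CV_radius_Li_coef.
Qed.

(** Multiplication by 1 - z takes differences of the coefficients, and the difference of
    consecutive harmonic sums is a coefficient of Li. *)
Lemma mhsum_PSeries ks z : Rabs z < 1 ->
  (1 - z) * PSeries (fun n => mhsum ks n.+1) z = LiOne ks z.
Proof.
move=> Hz; set h := fun n => mhsum ks n.+1.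
have Hr := in_radius (CV_radius_mhsum ks) Hz.
have eh : ex_pseries h z by apply: CV_radius_inside.
have eh' : ex_pseries (PS_decr_1 h) z.
  by apply: CV_radius_inside; rewrite CV_radius_decr_1.
have -> : (1 - z) * PSeries h z = PSeries h z - z * PSeries h z by ring.
rewrite {1}PSeries_decr_1 //.
have -> : h 0%nat + z * PSeries (PS_decr_1 h) z - z * PSeries h z
  = h 0%nat + z * PSeries (PS_minus (PS_decr_1 h) h) z.
  by rewrite PSeries_minus //; ring.
case/lastP: ks @h Hr eh eh' => [|ks k] h _ _ _.
  rewrite [PSeries _ z](@PSeries_ext _ (fun=> 0)).
    by rewrite PSeries_const_0 /h /mhsum /=; ring.
  by move=> n; rewrite /PS_minus /PS_plus /PS_opp /PS_decr_1 /h /mhsum /= plus_opp_r.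
rewrite /h mhsum_rcons1 LiOne_rcons Li_PSeries PSeries_incr_1 Rplus_0_l.
congr Rmult; apply: PSeries_ext => n.
change (mhsum (rcons ks k) n.+2 + - mhsum (rcons ks k) n.+1 = Li_coef (rcons ks k) n).
by rewrite mhsum_rconsS Li_coef_rcons; ring.
Qed.

Lemma Li_deriv1 ks z : Rabs z < 1 ->
  is_derive (Li (rcons ks 1%N)) z (LiOne ks z / (1 - z)).
Proof.
move=> Hz; have := Li_derivable ks 1%N Hz.
congr is_derive; eqR; rewrite -mhsum_PSeries //.
rewrite (@PSeries_ext _ (fun n => mhsum ks n.+1)).
  by field; move/Rabs_def2: Hz; lra.
by move=> n; rewrite Li_coef_rcons pow_1; field; apply: Rgt_not_eq.
Qed.

Lemma Li_derivS ks k z : z <> 0 -> Rabs z < 1 ->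
  is_derive (Li (rcons ks k.+2)) z (Li (rcons ks k.+1) z / z).
Proof.
move=> z0 Hz; have := Li_derivable ks k.+2 Hz.
congr is_derive; eqR; rewrite Li_PSeries PSeries_incr_1.
rewrite (@PSeries_ext _ (Li_coef (rcons ks k.+1))); first by field.
move=> n; rewrite !Li_coef_rcons -[INR n.+1 ^ k.+2]tech_pow_Rmult; field.
by split; [apply: pow_nonzero | ]; apply: Rgt_not_eq.
Qed.

Lemma Li_0 ks : Li ks 0 = 0.
Proof. by rewrite Li_PSeries PSeries_incr_1 Rmult_0_l. Qed.

Lemma ex_Li ks k z : Rabs z < 1 -> ex_series (fun n => Li_coef (rcons ks k) n * z ^ n.+1).
Proof.
move=> Hz; have := CV_disk_inside _ _ (in_radius (CV_radius_Li_coef ks k) Hz).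
move/ex_series_Rabs => /(ex_series_scal_l z) H.
apply: ex_series_ext H => n.
change (z * (Li_coef (rcons ks k) n * z ^ n) = Li_coef (rcons ks k) n * (z * z ^ n)); ring.
Qed.

Lemma Li_term ks k z n : 0 <= z -> 0 <= Li_coef (rcons ks k) n * z ^ n.+1.
Proof. by move=> Hz; apply: Rmult_le_pos; [exact: Li_coef_ge0 | exact: pow_le]. Qed.

Lemma sum_n_le_Series (a : nat -> R) N : (forall n, 0 <= a n) -> ex_series a ->
  sum_n a N <= Series a.
Proof.
move=> a0 ea; apply: (is_lim_seq_incr_compare (sum_n a)).
  exact: Series_correct.
by move=> n; rewrite sum_Sn /plus /=; have := a0 n.+1; lra.
Qed.

Lemma Li_ge0 ks k z : 0 <= z < 1 -> 0 <= Li (rcons ks k) z.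
Proof.
move=> Hz; have Hz' : Rabs z < 1 by rewrite Rabs_pos_eq; lra.
apply: Rle_trans (Li_term ks k 0 (proj1 Hz)) _.
have := @sum_n_le_Series _ 0 (fun n => Li_term ks k n (proj1 Hz)) (ex_Li ks k Hz').
by rewrite sum_O.
Qed.

Lemma LiOne_ge0 ks z : 0 <= z < 1 -> 0 <= LiOne ks z.
Proof.
case/lastP: ks => [|ks k] Hz; first by rewrite /LiOne; lra.
by rewrite LiOne_rcons; apply: Li_ge0.
Qed.

Lemma Li_le1 ks k z : 0 <= z < 1 -> Li (rcons ks k.+1) z <= Li (rcons ks 1%N) z.
Proof.
move=> Hz; have Hz' : Rabs z < 1 by rewrite Rabs_pos_eq; lra.
apply: Series_le; last exact: ex_Li.
move=> n; split; first exact: (Li_term _ _ _ (proj1 Hz)).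
apply: Rmult_le_compat_r; first by apply: pow_le; lra.
rewrite -!/(Li_coef _ _) !Li_coef_rcons; have [h _] := mhsum_bound ks n.
apply: Rmult_le_compat_l => //; apply: Rinv_le_contravar.
  exact: pow_lt.
by apply: Rle_pow; [rewrite S_INR; have := pos_INR n; lra | apply/leP].
Qed.

Lemma incr_of_deriv (f d : R -> R) a b : a <= b ->
  (forall t, a <= t <= b -> is_derive f t (d t)) ->
  (forall t, a <= t <= b -> 0 <= d t) -> f a <= f b.
Proof.
move=> ab df dp; have [||c [Hc e]] := MVT_gen f a b d.
- by move=> x; rewrite Rmin_left // Rmax_right // => Hx; apply: df; lra.
- move=> x; rewrite Rmin_left // Rmax_right // => Hx.
  by apply: derivable_continuous_pt; eexists; apply/is_derive_Reals/df.
move: Hc; rewrite Rmin_left // Rmax_right // => /dp Hc.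
by have : 0 <= d c * (b - a); [apply: Rmult_le_pos; lra | lra].
Qed.

(** Lowering all k_i to 1 increases the coefficients, and then the differential equation compares
    Li_{1,...,1} with a power of - log(1-z). *)
Lemma LiOne_bound ks z : all (fun k => 0 < k)%N ks -> 0 <= z < 1 ->
  LiOne ks z <= (- ln (1 - z)) ^ size ks.
Proof.
elim/last_ind: ks z => [|ks k IH] z; first by rewrite /LiOne /=; lra.
rewrite all_rcons => /andP [k0 ak] Hz; rewrite LiOne_rcons size_rcons.
case: k k0 => // k _; apply: Rle_trans (Li_le1 ks k Hz) _.
pose f t := (- ln (1 - t)) ^ (size ks).+1 - Li (rcons ks 1%N) t.
have f0 : f 0 = 0.
  by rewrite /f Li_0 !Rminus_0_r ln_1 Ropp_0 pow_i //; apply/ltP.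
suff : f 0 <= f z by rewrite f0 /f; lra.
apply: (@incr_of_deriv f (fun t => INR (size ks).+1 * (/ (1 - t)) * (- ln (1 - t)) ^ (size ks)
   - LiOne ks t / (1 - t)) 0 z); first lra.
all: move=> t Ht.
- apply: is_derive_minus; last by apply: Li_deriv1; rewrite Rabs_pos_eq; lra.
  auto_derive; first lra.
  rewrite -/(INR (size ks).+1) -/(1 - t); field; lra.
- have -> : INR (size ks).+1 * / (1 - t) * (- ln (1 - t)) ^ size ks - LiOne ks t / (1 - t)
   = (INR (size ks).+1 * (- ln (1 - t)) ^ size ks - LiOne ks t) * / (1 - t) by field; lra.
  apply: Rmult_le_pos; last by apply/Rlt_le/Rinv_0_lt_compat; lra.
  have H1 := IH t ak ltac:(lra).
  have H2 : 0 <= LiOne ks t by apply: LiOne_ge0; lra.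
  have H3 : 0 <= INR (size ks) * (- ln (1 - t)) ^ size ks.
    by apply: Rmult_le_pos; [apply: pos_INR | lra].
  rewrite S_INR; lra.
Qed.

Lemma Li_small ks k : exists C, 0 <= C /\
  forall z, 0 <= z <= / 4 -> Li (rcons ks k) z <= C * z.
Proof.
(* Li(z)/z is increasing; its value at 1/4 *)
exists (Series (fun n => Li_coef (rcons ks k) n * (/ 4) ^ n)).
have e4 : Rabs (/ 4) < 1 by rewrite Rabs_pos_eq; lra.
have ex4 : ex_series (fun n => Li_coef (rcons ks k) n * (/ 4) ^ n).
  exact/ex_series_Rabs/(CV_disk_inside _ _ (in_radius (CV_radius_Li_coef ks k) e4)).
have p4 n : 0 <= Li_coef (rcons ks k) n * (/ 4) ^ n.
  by apply: Rmult_le_pos; [exact: Li_coef_ge0 | apply: pow_le; lra].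
split.
  by apply: Rle_trans (sum_n_le_Series 0 p4 ex4); rewrite sum_O.
move=> z Hz; rewrite Li_PSeries PSeries_incr_1 Rmult_comm.
apply: Rmult_le_compat_r; first lra.
apply: Series_le => // n; split.
  by apply: Rmult_le_pos; [exact: Li_coef_ge0 | apply: pow_le; lra].
apply: Rmult_le_compat_l; [exact: Li_coef_ge0 | apply: pow_incr; lra].
Qed.

(** * Multiple zeta values as limits of polylogarithms *)

Lemma ln4_gt1 s : 0 < s < / 4 -> 1 < - ln s.
Proof.
move=> Hs; rewrite -ln_Rinv; last lra.
rewrite -[1]ln_exp; apply: ln_increasing; first exact: exp_pos.
(* log 4 > 1 since 4 > e *)
have H4 : 4 < / s.
  by rewrite -[4]Rinv_inv; apply: Rinv_lt_contravar; [apply: Rmult_lt_0_compat|]; lra.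
by have := exp_le_3; lra.
Qed.

Lemma left_limit_le (f : R -> R) B s : 0 < s -> continuous f 1 ->
  (forall s', 0 < s' < s -> f (1 - s') <= B) -> f 1 <= B.
Proof.
move=> Hs cf H; apply: Rnot_lt_le => HB.
have e0 : 0 < f 1 - B by lra.
have /cf [d Hd] : locally (f 1) (fun y => B < y).
  exists (mkposreal _ e0) => y Hy.
  have {Hy} : Rabs (y - f 1) < f 1 - B := Hy.
  by move/Rabs_def2 => [? ?]; lra.
pose s' := Rmin (s / 2) (d / 2); have dp := cond_pos d.
have Hs' : 0 < s' < s /\ s' < d.
  by rewrite /s' /Rmin; case: Rle_dec => ?; lra.
have := Hd (1 - s'); have := H s' (proj1 Hs').
move=> h1 h2; have : B < f (1 - s').
  apply: h2; change (Rabs (1 - s' - 1) < d).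
  by rewrite Rabs_left; lra.
lra.
Qed.

(** The rate of convergence of Li(1 - s) to zeta as s -> 0 is needed.  Since the derivative of
    Li(1-s) is at most of the order of |log s|^(n+1), a multiple of s |log s|^(n+1) compensates
    its decrease; the sum of both is increasing in s, hence bounds all the partial sums of
    zeta. *)
Section ZetaLimit.
Variables (ks : seq nat) (k n : nat).
Hypothesis bound : forall t, 0 <= t < 1 -> Li (rcons ks k.+1) t <= (- ln (1 - t)) ^ n.+1.

Let K := 2 * INR n.+1.
(* K = 2 (n+1) ensures that (K - log s)^(n+1) dominates twice its derivative in log s *)
Let H s := 4 * s * (K - ln s) ^ n.+1 + Li (rcons ks k.+2) (1 - s).

Lemma majorant_incr s s' : 0 < s' <= s -> s <= / 2 -> H s' <= H s.
Proof.
move=> h1 h2; pose d t := 4 * ((K - ln t) ^ n.+1 - INR n.+1 * (K - ln t) ^ n)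
  - Li (rcons ks k.+1) (1 - t) / (1 - t).
apply: (@incr_of_deriv H d); first lra.
- move=> t Ht; rewrite /H /d.
  apply: is_derive_plus; last first.
    have -> : - (Li (rcons ks k.+1) (1 - t) / (1 - t)) =
      (0 - 1) * (Li (rcons ks k.+1) (1 - t) / (1 - t)) by ring.
    apply: (is_derive_comp (Li (rcons ks k.+2)) (fun t => 1 - t)).
      by apply: Li_derivS; [lra | rewrite Rabs_pos_eq; lra].
    by apply: is_derive_minus; [exact: is_derive_const | exact: is_derive_id].
  auto_derive; first by lra.
  rewrite /= -/(INR n.+1) -/(K - ln t); field; lra.
- move=> t Ht; rewrite /d.
  have lt0 : ln t <= 0 by rewrite -ln_1; apply: ln_le; lra.
  have n0 := pos_INR n; have HK : 0 <= K by rewrite /K S_INR; lra.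
  have X0 : 0 <= (K - ln t) ^ n by apply: pow_le; lra.
  have h3 : INR n.+1 * (K - ln t) ^ n <= (K - ln t) / 2 * (K - ln t) ^ n.
    by apply: Rmult_le_compat_r => //; rewrite /K; lra.
  have h4 := bound (t := 1 - t) ltac:(lra).
  rewrite (_ : 1 - (1 - t) = t) in h4; last ring.
  have h5 : (- ln t) ^ n.+1 <= (K - ln t) ^ n.+1 by apply: pow_incr; lra.
  have h6 : Li (rcons ks k.+1) (1 - t) / (1 - t) <= (K - ln t) ^ n.+1 * 2.
    apply: Rmult_le_compat; [apply: Li_ge0; lra | | lra | ].
      by apply/Rlt_le/Rinv_0_lt_compat; lra.
    by rewrite -[2]Rinv_inv; apply: Rinv_le_contravar; lra.
  rewrite -[(K - ln t) ^ n.+1]tech_pow_Rmult in h6 *; lra.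
Qed.

Lemma partial_zeta_le s N : 0 < s <= / 2 -> sum_n (Li_coef (rcons ks k.+2)) N <= H s.
Proof.
move=> Hs; pose f z := sum_n (fun i => Li_coef (rcons ks k.+2) i * z ^ i.+1) N.
have -> : sum_n (Li_coef (rcons ks k.+2)) N = f 1.
  by apply: sum_n_ext => i; rewrite pow1 Rmult_1_r.
apply: (@left_limit_le f _ s); first lra.
  rewrite /f; elim: N {f} => [|N IH].
    apply: (continuous_ext (fun z => Li_coef (rcons ks k.+2) 0 * z ^ 1)).
      by move=> x; rewrite sum_O.
    by apply: ex_derive_continuous; auto_derive.
  apply: (continuous_ext (fun z => plus (sum_n (fun i => Li_coef (rcons ks k.+2) i * z ^ i.+1) N)
     (Li_coef (rcons ks k.+2) N.+1 * z ^ N.+2))).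
    by move=> x; rewrite sum_Sn.
  apply: continuous_plus => //.
  by apply: ex_derive_continuous; auto_derive.
move=> s' Hs'; have Hs'1 : Rabs (1 - s') < 1 by rewrite Rabs_pos_eq; lra.
apply: Rle_trans (majorant_incr (s' := s') (s := s) ltac:(lra) ltac:(lra)).
have H1 : f (1 - s') <= Li (rcons ks k.+2) (1 - s').
  by apply: sum_n_le_Series; [move=> i; apply: Li_term; lra | exact: ex_Li].
suff : 0 <= 4 * s' * (K - ln s') ^ n.+1 by rewrite /H; lra.
apply: Rmult_le_pos; first lra.
have lt0 : ln s' <= 0 by rewrite -ln_1; apply: ln_le; lra.
by apply: pow_le; rewrite /K; have := pos_INR n.+1; lra.
Qed.

Lemma zeta_converges : ex_series (Li_coef (rcons ks k.+2)).
Proof.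
have [l Hl] : ex_finite_lim_seq (sum_n (Li_coef (rcons ks k.+2))).
  apply: (@ex_finite_lim_seq_incr _ (H (/ 2))) => i.
    by rewrite sum_Sn /plus /=; have := Li_coef_ge0 ks k.+2 i.+1; lra.
  by apply: partial_zeta_le; lra.
by exists l.
Qed.

Lemma zeta_le s : 0 < s <= / 2 -> zeta (rcons ks k.+2) <= H s.
Proof.
move=> Hs; have h := Series_correct _ zeta_converges.
change (Rbar_le (Series (Li_coef (rcons ks k.+2))) (H s)).
apply: (@is_lim_seq_le (sum_n (Li_coef (rcons ks k.+2))) (fun=> H s)) => [N||].
- exact: partial_zeta_le.
- exact: h.
- exact: is_lim_seq_const.
Qed.

Lemma Li_le_zeta z : 0 <= z < 1 -> Li (rcons ks k.+2) z <= zeta (rcons ks k.+2).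
Proof.
move=> Hz; apply: Series_le; last exact: zeta_converges.
move=> i; split; first exact: (Li_term _ _ _ (proj1 Hz)).
rewrite -!/(Li_coef _ _) -[X in _ <= X]Rmult_1_r.
apply: Rmult_le_compat_l; first exact: Li_coef_ge0.
by rewrite -(pow1 i.+1); apply: pow_incr; lra.
Qed.

Lemma zeta_Li_rate s : 0 < s < / 4 ->
  Rabs (Li (rcons ks k.+2) (1 - s) - zeta (rcons ks k.+2)) <=
  4 * (K + 1) ^ n.+1 * s * (- ln s) ^ n.+1.
Proof.
move=> Hs; have h1 := zeta_le (s := s) ltac:(lra).
have h2 := Li_le_zeta (z := 1 - s) ltac:(lra).
have h3 : (K - ln s) ^ n.+1 <= (K + 1) ^ n.+1 * (- ln s) ^ n.+1.
  rewrite -Rpow_mult_distr; apply: pow_incr.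
  have := ln4_gt1 Hs; have : 0 <= K by rewrite /K; have := pos_INR n.+1; lra.
  move=> K0 l1; split; first lra.
  suff : 0 <= K * (- ln s - 1) by lra.
  by apply: Rmult_le_pos; lra.
rewrite Rabs_left1; last lra.
have := Rmult_le_compat_l (4 * s) _ _ ltac:(lra) h3; rewrite /H in h1; lra.
Qed.
End ZetaLimit.

(** * Errors up to powers of logarithms *)

Lemma density_cont w t : 0 < t < 1 -> continuous (density w) t.
Proof.
move=> Ht; apply: ex_derive_continuous; case: w; rewrite /density.
  by auto_derive; apply: Rgt_not_eq; lra.
by auto_derive; apply: Rgt_not_eq; lra.
Qed.

Definition dens (w : form) : cfun := Cfun (@density_cont w).

Definition ell (e h : R) : R := - ln e - ln h.

Definition logO_scale (small : bool) (e h : R) : R := if small then e + h else 1.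

(** Growth at most a power of ell (b = false), or a small error (b = true). *)
Definition logO (b : bool) (F : R -> R -> R -> R) : Prop :=
  exists n C, 0 <= C /\ forall e h z, 0 < e < / 4 -> 0 < h < / 4 ->
    e <= z <= 1 - h -> Rabs (F e h z) <= C * logO_scale b e h * ell e h ^ n.

Lemma ell_ge1 e h : 0 < e < / 4 -> 0 < h < / 4 -> 1 <= ell e h.
Proof. by move=> /ln4_gt1 H1 /ln4_gt1 H2; rewrite /ell; lra. Qed.

Lemma logO_scale_ge0 b e h : 0 < e < / 4 -> 0 < h < / 4 -> 0 <= logO_scale b e h <= 1.
Proof. by case: b => /= *; lra. Qed.

Lemma logO_ext b F G :
  (forall e h z, 0 < e < / 4 -> 0 < h < / 4 -> e <= z <= 1 - h -> F e h z = G e h z) ->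
  logO b F -> logO b G.
Proof.
move=> FG [n [C [C0 HC]]]; exists n, C; split=> // e h z He Hh Hz.
by rewrite -FG //; apply: HC.
Qed.

Lemma logO_add b F G : logO b F -> logO b G -> logO b (fun e h z => F e h z + G e h z).
Proof.
move=> [n [C [C0 HC]]] [m [D [D0 HD]]]; exists (n + m)%N, (C + D).
split=> [|e h z He Hh Hz]; first lra.
have l1 := ell_ge1 He Hh; have sc := logO_scale_ge0 b He Hh.
apply: Rle_trans (Rabs_triang _ _) _.
have h1 : Rabs (F e h z) <= C * logO_scale b e h * ell e h ^ (n + m).
  apply: Rle_trans (HC _ _ _ He Hh Hz) _.
  apply: Rmult_le_compat_l; first by apply: Rmult_le_pos; lra.
  by apply: Rle_pow => //; apply/leP/leq_addr.
have h2 : Rabs (G e h z) <= D * logO_scale b e h * ell e h ^ (n + m).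
  apply: Rle_trans (HD _ _ _ He Hh Hz) _.
  apply: Rmult_le_compat_l; first by apply: Rmult_le_pos; lra.
  by apply: Rle_pow => //; apply/leP/leq_addl.
lra.
Qed.

Lemma logO_mul b F G : logO b F -> logO false G -> logO b (fun e h z => F e h z * G e h z).
Proof.
move=> [n [C [C0 HC]]] [m [D [D0 HD]]]; exists (n + m)%N, (C * D).
split=> [|e h z He Hh Hz]; first exact: Rmult_le_pos.
rewrite Rabs_mult pow_add.
have -> : C * D * logO_scale b e h * (ell e h ^ n * ell e h ^ m)
  = (C * logO_scale b e h * ell e h ^ n) * (D * 1 * ell e h ^ m) by ring.
by apply: Rmult_le_compat; [apply: Rabs_pos | apply: Rabs_pos | apply: HC | apply: HD].
Qed.

Lemma logO_opp b F : logO b F -> logO b (fun e h z => - F e h z).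
Proof.
move=> [n [C [C0 HC]]]; exists n, C; split=> // e h z He Hh Hz.
by rewrite Rabs_Ropp; apply: HC.
Qed.

Lemma logO_sub b F G : logO b F -> logO b G -> logO b (fun e h z => F e h z - G e h z).
Proof. by move=> HF HG; apply: logO_add HF (logO_opp HG). Qed.

Lemma logO_weaken F : logO true F -> logO false F.
Proof.
move=> [n [C [C0 HC]]]; exists n, C; split=> // e h z He Hh Hz.
apply: Rle_trans (HC _ _ _ He Hh Hz) _.
have l1 := ell_ge1 He Hh; have sc := logO_scale_ge0 true He Hh.
apply: Rmult_le_compat_r; first by apply: pow_le; lra.
by apply: Rmult_le_compat_l => //=; case: sc.
Qed.

Lemma logO_const c : logO false (fun _ _ _ => c).
Proof.
exists 0%N, (Rabs c); split=> [|e h z *]; first exact: Rabs_pos.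
by rewrite /= !Rmult_1_r; right.
Qed.

Lemma logO_0 b : logO b (fun _ _ _ => 0).
Proof.
exists 0%N, 0; split=> [|e h z *]; first by right.
by rewrite Rabs_R0 !Rmult_0_l; right.
Qed.

Lemma logO_lne : logO false (fun e _ _ => ln e).
Proof.
exists 1%N, 1; split=> [|e h z He Hh Hz]; first lra.
have := ln4_gt1 He; have := ln4_gt1 Hh => h1 h2.
rewrite Rabs_left; last lra.
by rewrite /= /ell; lra.
Qed.

Lemma logO_lnh : logO false (fun _ h _ => ln h).
Proof.
exists 1%N, 1; split=> [|e h z He Hh Hz]; first lra.
have := ln4_gt1 He; have := ln4_gt1 Hh => h1 h2.
rewrite Rabs_left; last lra.
by rewrite /= /ell; lra.
Qed.

Lemma logO_at b F p : (forall e h, 0 < e < / 4 -> 0 < h < / 4 -> e <= p e h <= 1 - h) ->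
  logO b F -> logO b (fun e h _ => F e h (p e h)).
Proof.
move=> Hp [n [C [C0 HC]]]; exists n, C; split=> // e h z He Hh Hz.
by apply: HC => //; apply: Hp.
Qed.

Definition prim (w : form) (z : R) : R :=
  match w with Form0 => ln z | Form1 => - ln (1 - z) end.

Lemma prim_deriv w z : 0 < z < 1 -> is_derive (prim w) z (density w z).
Proof.
move=> Hz; case: w; rewrite /prim /density.
  by auto_derive; [lra | field; lra].
by auto_derive; [lra | field; lra].
Qed.

Lemma density_ge0 w z : 0 < z < 1 -> 0 <= density w z.
Proof. by move=> Hz; case: w => /=; apply/Rlt_le/Rinv_0_lt_compat; lra. Qed.

(** The reason why only powers of ell are lost: the mass of both forms on [e, 1 - h] is at most
    ell. *)
Lemma prim_le_ell w e h z : 0 < e < / 4 -> 0 < h < / 4 -> e <= z <= 1 - h ->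
  prim w z - prim w e <= ell e h.
Proof.
move=> He Hh Hz; have h1 := ln4_gt1 He; have h2 := ln4_gt1 Hh; rewrite /ell.
case: w => /=.
  have : ln z <= 0 by rewrite -ln_1; apply: ln_le; lra.
  lra.
have : ln h <= ln (1 - z) by apply: ln_le; lra.
have : ln (1 - e) <= 0 by rewrite -ln_1; apply: ln_le; lra.
lra.
Qed.

Definition cont01 (F : R -> R -> R -> R) := forall e h t,
  0 < e < / 4 -> 0 < h < / 4 -> 0 < t < 1 -> continuous (F e h) t.

Lemma logO_int b F w : cont01 F -> logO b F ->
  logO b (fun e h z => RInt (fun t => F e h t * density w t) e z).
Proof.
move=> cF [n [C [C0 HC]]]; exists n.+1, C; split=> // e h z He Hh Hz.
set M := C * logO_scale b e h * ell e h ^ n.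
have l1 := ell_ge1 He Hh; have sc := logO_scale_ge0 b He Hh.
have M0 : 0 <= M.
  by apply: Rmult_le_pos; [apply: Rmult_le_pos; lra | apply: pow_le; lra].
have He1 : 0 < e < 1 by lra.
have Hz1 : 0 < z < 1 by lra.
have H := @norm_RInt_le R_NormedModule (fun t => F e h t * density w t)
  (fun t => M * density w t) e z (RInt (fun t => F e h t * density w t) e z)
  (M * (prim w z - prim w e)).
apply: Rle_trans (H _ _ _ _) _.
- lra.
- move=> t Ht; rewrite /norm /= /abs /= Rabs_mult [Rabs (density w t)]Rabs_pos_eq.
    apply: Rmult_le_compat_r; first by apply: density_ge0; lra.
    by apply: HC => //; lra.
  by apply: density_ge0; lra.
- apply: RInt_correct; apply: RInt_cont01 => // t Ht.
  by apply: continuous_mult; [apply: cF | apply: density_cont].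
- apply: (is_RInt_scal (density w) e z M).
  apply: (is_RInt_derive (prim w)) => t.
    by move/(between01 He1 Hz1); apply: prim_deriv.
  by move/(between01 He1 Hz1); apply: density_cont.
have -> : C * logO_scale b e h * ell e h ^ n.+1 = M * ell e h by rewrite /M /=; ring.
by apply: Rmult_le_compat_l => //; apply: prim_le_ell.
Qed.

(** * Polylogarithms as iterated integrals *)

Definition wint (a : R) (w : seq form) (z : R) : R := itr a (map dens w) z.

Lemma logO_wint w : logO false (fun e _ z => wint e w z).
Proof.
elim: w => [|x w IH]; first exact: logO_const.
apply: (logO_int x _ IH) => e h t He Hh Ht.
by apply: itr_cont; lra.
Qed.

(** The index of the polylogarithm given by a word, last entry first, for a word whose innermost
    letter is dt/(1-t): the letter dt/(1-t) opens a new entry and dt/t increments the current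
    one. *)
Fixpoint windex (w : seq form) : seq nat :=
  match w with
  | [::] => [::]
  | Form1 :: w' => 1%N :: windex w'
  | Form0 :: w' => if windex w' is k :: ks then k.+1 :: ks else [::]
  end.

Definition Li_word (w : seq form) : R -> R := LiOne (rev (windex w)).

Lemma windex_pos w : all (fun k => 0 < k)%N (windex w).
Proof. by elim: w => [|[] w IH] //=; case: (windex w) IH => //= k ks /andP[]. Qed.

Lemma windex_neq0 x w : last x w = Form1 -> windex (x :: w) <> [::].
Proof.
elim: w x => [|y w IH] x /=; first by move=> ->.
move/IH => {IH} /=; case: x => //=.
by case: y => //; case: (windex w).
Qed.

(** The polylogarithm of a word and the iterated integral of this word satisfy the same
    differential equation. *)
Lemma Li_word_deriv x w z : last x w = Form1 -> 0 < z < 1 ->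
  is_derive (Li_word (x :: w)) z (Li_word w z * density x z).
Proof.
move=> xw Hz; have Hz' : Rabs z < 1 by rewrite Rabs_pos_eq; lra.
case: x xw => xw; last first.
  rewrite /Li_word /= rev_cons LiOne_rcons; exact: Li_deriv1.
case: w xw => [|y w] //= xw.
rewrite /Li_word [windex (Form0 :: _)]/= -/(windex (y :: w)).
have := windex_neq0 xw; have := windex_pos (y :: w).
case: (windex (y :: w)) => [|[|k] ks] // _ _.
rewrite !rev_cons !LiOne_rcons; apply: Li_derivS => //; lra.
Qed.

Lemma Li_word_small x w : last x w = Form1 -> exists C, 0 <= C /\
  forall z, 0 <= z <= / 4 -> Rabs (Li_word (x :: w) z) <= C * z.
Proof.
move/windex_neq0; rewrite /Li_word; case: (windex (x :: w)) => // k ks _.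
rewrite rev_cons LiOne_rcons; have [C [C0 HC]] := Li_small (rev ks) k.
exists C; split=> // z Hz; rewrite Rabs_pos_eq; first exact: HC.
by apply: Li_ge0; lra.
Qed.

Lemma logO_Li_word w : logO false (fun _ _ z => Li_word w z).
Proof.
exists (size (rev (windex w))), 1; split=> [|e h z He Hh Hz]; first lra.
rewrite Rabs_pos_eq; last by apply: LiOne_ge0; lra.
have H := @LiOne_bound (rev (windex w)) z.
apply: Rle_trans (H _ _) _; first by rewrite all_rev; exact: windex_pos.
  lra.
rewrite !Rmult_1_l; apply: pow_incr; split.
  have : ln (1 - z) <= 0 by rewrite -ln_1; apply: ln_le; lra.
  lra.
have := @prim_le_ell Form1 e h z He Hh Hz; rewrite /= => H1.
have h1 := ln4_gt1 He.
have : ln h <= ln (1 - z) by apply: ln_le; lra.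
rewrite /ell; lra.
Qed.

Lemma Li_word_cont w z : last Form1 w = Form1 -> 0 < z < 1 -> continuous (Li_word w) z.
Proof.
case: w => [|x w] /= xw Hz.
  apply: (continuous_ext (fun=> 1)); [by [] | exact: continuous_const].
by apply: ex_derive_continuous; eexists; exact: Li_word_deriv.
Qed.

(** The series is the iterated integral from 0, so the difference obeys the same recursion with
    initial value the polylogarithm at e, which is O(e). *)
Theorem wint_Li_word w : last Form1 w = Form1 ->
  logO true (fun e h z => wint e w z - Li_word w z).
Proof.
elim: w => [|x w IH] /= xw.
  apply: logO_ext (logO_0 true) => e h z *; rewrite /wint /Li_word /=; ring.
have xw' : last Form1 w = Form1 by case: w xw {IH}.
have {IH} := @logO_int true _ x _ (IH xw').
have cw : cont01 (fun e h z => wint e w z - Li_word w z).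
  move=> e h t He Hh Ht; apply: (continuous_minus (wint e w) (Li_word w)).
    by apply: itr_cont; lra.
  exact: Li_word_cont.
move=> /(_ cw) H.
have [C [C0 HC]] := Li_word_small xw.
have He : logO true (fun e h z => Li_word (x :: w) e).
  exists 0%N, C; split=> // e h z He Hh Hz.
  apply: Rle_trans (HC e _) _; first lra.
  by rewrite /= Rmult_1_r; apply: Rmult_le_compat_l; lra.
apply: logO_ext (logO_sub H He) => e h z Hee Hh Hz /=.
have He1 : 0 < e < 1 by lra.
have Hz1 : 0 < z < 1 by lra.
apply: (@eq_of_deriv
  (fun z => RInt (fun t => (wint e w t - Li_word w t) * density x t) e z - Li_word (x :: w) e)
  (fun z => wint e (x :: w) z - Li_word (x :: w) z)
  (fun t => (wint e w t - Li_word w t) * density x t) e z) => //.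
- move=> t Ht.
  rewrite -[X in is_derive _ _ X]Rminus_0_r; apply: is_derive_minus; last exact: is_derive_const.
  apply: (RInt_deriv01 (h := fun t => (wint e w t - Li_word w t) * density x t)) => // s Hs.
  apply: (continuous_mult (fun t => wint e w t - Li_word w t) (density x)).
    exact: (cw e h).
  exact: density_cont.
- move=> t Ht; rewrite Rmult_minus_distr_r; apply: is_derive_minus.
    exact: (@itr_deriv e (dens x) (map dens w)).
  exact: Li_word_deriv.
- by rewrite RInt_point /wint /= RInt_point.
Qed.

(** * Expansions in the logarithms of the cut-offs *)

Definition eval2 (P : {poly {poly R}}) (x y : R) : R := (P.[x%:P].[y])%R.

Lemma eval2D P Q x y : eval2 (P + Q)%R x y = eval2 P x y + eval2 Q x y.
Proof. by rewrite /eval2 !hornerD. Qed.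
Lemma eval2M P Q x y : eval2 (P * Q)%R x y = eval2 P x y * eval2 Q x y.
Proof. by rewrite /eval2 !hornerM. Qed.
Lemma eval2C c x y : eval2 c%:P%:P x y = c.
Proof. by rewrite /eval2 !hornerC. Qed.
Lemma eval2X x y : eval2 'X x y = x.
Proof. by rewrite /eval2 hornerX hornerC. Qed.
Lemma eval2Y x y : eval2 ('X)%:P x y = y.
Proof. by rewrite /eval2 hornerC hornerX. Qed.
Lemma eval2_swap P x y : eval2 (swapXY P) x y = eval2 P y x.
Proof. by rewrite /eval2 horner2_swapXY. Qed.

Lemma logO_eval2 P : logO false (fun e h _ => eval2 P (ln e) (ln h)).
Proof.
elim/poly_ind: P => [|P c IH].
  by apply: logO_ext (logO_0 _) => e h z *; rewrite /eval2 !horner0.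
apply: (@logO_ext _ (fun e h z => eval2 P (ln e) (ln h) * ln e + eval2 c%:P (ln e) (ln h))).
  by move=> e h z *; rewrite eval2D eval2M eval2X.
apply: logO_add; first exact: (logO_mul IH logO_lne).
elim/poly_ind: c => [|c d IHc].
  by apply: logO_ext (logO_0 _) => e h z *; rewrite /eval2 hornerC horner0.
apply: (@logO_ext _ (fun e h z => eval2 c%:P (ln e) (ln h) * ln h + d)).
  by move=> e h z *; rewrite polyCD polyCM eval2D eval2M eval2C eval2Y.
by apply: logO_add; [exact: (logO_mul IHc logO_lnh) | exact: logO_const].
Qed.

Definition log_expands (g : R -> R -> R) P :=
  logO true (fun e h _ => g e h - eval2 P (ln e) (ln h)).

(** Only the constant term of the expansion is required to be a polynomial in multiple zeta
    values: evaluation at (0,0) is a ring morphism, and this suffices for the induction. *)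
Definition mzv_expandable (g : R -> R -> R) :=
  exists P, log_expands g P /\ mzv_algebra (eval2 P 0 0).

Lemma log_expands_ext f g P : (forall e h, 0 < e < / 4 -> 0 < h < / 4 -> f e h = g e h) ->
  log_expands f P -> log_expands g P.
Proof. by move=> fg; apply: logO_ext => e h z He Hh _; rewrite fg. Qed.

Lemma log_expands_add f g P Q : log_expands f P -> log_expands g Q ->
  log_expands (fun e h => f e h + g e h) (P + Q)%R.
Proof.
move=> fP gQ; apply: logO_ext (logO_add fP gQ) => e h z *; rewrite eval2D; ring.
Qed.

Lemma log_expands_logO f P : log_expands f P -> logO false (fun e h _ => f e h).
Proof.
move=> fP; apply: logO_ext (logO_add (logO_weaken fP) (logO_eval2 P)) => e h z *; ring.
Qed.

Lemma log_expands_mul f g P Q : log_expands f P -> log_expands g Q ->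
  log_expands (fun e h => f e h * g e h) (P * Q)%R.
Proof.
move=> fP gQ.
apply: logO_ext (logO_add (logO_mul fP (logO_eval2 Q))
  (logO_mul gQ (log_expands_logO fP))) => e h z *.
by rewrite eval2M; ring.
Qed.

Lemma log_expands_const c : log_expands (fun _ _ => c) c%:P%:P.
Proof. by apply: logO_ext (logO_0 _) => e h z *; rewrite eval2C; ring. Qed.

Lemma log_expands_small f g P :
  logO true (fun e h _ => f e h - g e h) -> log_expands g P -> log_expands f P.
Proof. by move=> H gP; apply: logO_ext (logO_add H gP) => e h z *; ring. Qed.

Lemma logO_swap b F : logO b (fun e h _ => F e h) -> logO b (fun e h _ => F h e).
Proof.
move=> [n [C [C0 HC]]]; exists n, C; split=> // e h z He Hh Hz.
have -> : logO_scale b e h = logO_scale b h e by case: b {HC} => //=; ring.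
have -> : ell e h = ell h e by rewrite /ell; ring.
by apply: (HC h e h) => //; lra.
Qed.

Lemma mzv_0 : mzv_algebra 0.
Proof. by have := mzv_rat 0; rewrite raddf0. Qed.
Lemma mzv_1 : mzv_algebra 1.
Proof. by have := mzv_rat 1; rewrite rmorph1. Qed.

Lemma mzv_expandable_ext f g : (forall e h, 0 < e < / 4 -> 0 < h < / 4 -> f e h = g e h) ->
  mzv_expandable f -> mzv_expandable g.
Proof. by move=> fg [P [fP ?]]; exists P; split=> //; apply: log_expands_ext fP. Qed.

Lemma mzv_expandable_add f g : mzv_expandable f -> mzv_expandable g ->
  mzv_expandable (fun e h => f e h + g e h).
Proof.
move=> [P [fP zP]] [Q [gQ zQ]]; exists (P + Q)%R; split; first exact: log_expands_add.
by rewrite eval2D; apply: mzv_add.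
Qed.

Lemma mzv_expandable_mul f g : mzv_expandable f -> mzv_expandable g ->
  mzv_expandable (fun e h => f e h * g e h).
Proof.
move=> [P [fP zP]] [Q [gQ zQ]]; exists (P * Q)%R; split; first exact: log_expands_mul.
by rewrite eval2M; apply: mzv_mul.
Qed.

Lemma mzv_expandable_const c : mzv_algebra c -> mzv_expandable (fun _ _ => c).
Proof. by move=> zc; exists (c%:P%:P)%R; rewrite eval2C; split=> //; exact: log_expands_const. Qed.

Lemma mzv_expandable_rat q : mzv_expandable (fun _ _ => ratr q).
Proof. by apply: mzv_expandable_const; apply: mzv_rat. Qed.

Lemma mzv_expandable_opp f : mzv_expandable f -> mzv_expandable (fun e h => - f e h).
Proof.
move=> Ef; apply: (@mzv_expandable_ext (fun e h => ratr (-1) * f e h)).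
  by move=> e h _ _; rewrite rmorphN rmorph1; change (-1 * f e h = - f e h); ring.
exact: (mzv_expandable_mul (mzv_expandable_rat _) Ef).
Qed.

Lemma mzv_expandable_scale_inv n f :
  mzv_expandable (fun e h => INR n.+1 * f e h) -> mzv_expandable f.
Proof.
move=> Ef; apply: (@mzv_expandable_ext (fun e h => ratr (n.+1%:R^-1)%R * (INR n.+1 * f e h))).
  have -> : ratr (n.+1%:R^-1)%R = / INR n.+1 by rewrite RinvE INRE fmorphV /= ratr_nat.
  move=> e h _ _.
  change (/ INR n.+1 * (INR n.+1 * f e h) = f e h); field; apply: Rgt_not_eq; exact: INR_gt0.
exact: (mzv_expandable_mul (mzv_expandable_rat _) Ef).
Qed.

Lemma mzv_expandable_small f g : logO true (fun e h _ => f e h - g e h) ->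
  mzv_expandable g -> mzv_expandable f.
Proof. by move=> H [P [gP zP]]; exists P; split=> //; exact: log_expands_small gP. Qed.

Lemma mzv_expandable_swap f : mzv_expandable f -> mzv_expandable (fun e h => f h e).
Proof.
move=> [P [fP zP]]; exists (swapXY P); rewrite eval2_swap; split=> //.
by apply: logO_ext (logO_swap fP) => e h z *; rewrite eval2_swap.
Qed.

Lemma mzv_expandable_lnh : mzv_expandable (fun _ h => ln h).
Proof.
exists ('X%:P)%R; rewrite eval2Y; split; last exact: mzv_0.
by apply: logO_ext (logO_0 _) => e h z *; rewrite eval2Y; ring.
Qed.

Definition wcut (w : seq form) (e h : R) : R := wint e w (1 - h).

(** * Regularization of the integrals of words *)

(** The word is that of an index whose last entry is at least 2, up to small errors at both
    ends. *)
Lemma mzv_expandable_convergent w : w <> [::] -> last Form1 w = Form1 ->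
  mzv_expandable (wcut (Form0 :: w)).
Proof.
case: w => [|x w] // _ xw.
have [k [ks ek]] : exists k ks, windex (Form0 :: x :: w) = k.+2 :: ks.
  have := @windex_neq0 x w xw; have := windex_pos (x :: w).
  rewrite [windex (Form0 :: _)]/= -/(windex (x :: w)).
  case: (windex (x :: w)) => [_ []|k ks] //= /andP[k0 _] _.
  by case: k k0 => // k _; exists k, ks.
have hpos := windex_pos (Form0 :: x :: w).
have hi : (rev (windex (Form0 :: x :: w)) != [::]) &&
    all (fun k => 0 < k)%N (rev (windex (Form0 :: x :: w))).
  by rewrite all_rev hpos ek rev_cons; case: (rev ks).
pose i : index :=
  exist (fun ks : seq nat => is_true ((ks != [::]) && all (fun k => 0 < k)%N ks)) _ hi.
have zi : mzv_algebra (zeta (rev (windex (Form0 :: x :: w)))).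
  apply: (mzv_zeta (k := i)); change (1 < last 0%N (rev (windex (Form0 :: x :: w))))%N.
  by rewrite ek rev_cons last_rcons.
apply: mzv_expandable_small (mzv_expandable_const zi).
apply: (@logO_ext _ (fun e h _ =>
   (wint e (Form0 :: x :: w) (1 - h) - Li_word (Form0 :: x :: w) (1 - h))
   + (Li_word (Form0 :: x :: w) (1 - h) - zeta (rev (windex (Form0 :: x :: w)))))).
  by move=> e h z *; rewrite /wcut; ring.
apply: logO_add.
  apply: (@logO_at _ (fun e h z => wint e (Form0 :: x :: w) z - Li_word (Form0 :: x :: w) z)
    (fun _ h => 1 - h)).
    by move=> *; lra.
  exact: wint_Li_word.
have hb t : 0 <= t < 1 -> Li (rcons (rev ks) k.+1) t <= (- ln (1 - t)) ^ (size ks).+1.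
  move=> Ht; have := @LiOne_bound (rcons (rev ks) k.+1) t.
  rewrite LiOne_rcons size_rcons size_rev; apply => //.
  by move: hpos; rewrite ek /= all_rcons all_rev.
rewrite /Li_word ek rev_cons LiOne_rcons.
exists (size ks).+1, (4 * (2 * INR (size ks).+1 + 1) ^ (size ks).+1); split.
  apply: Rmult_le_pos; first lra.
  by apply: pow_le; have := pos_INR (size ks).+1; lra.
move=> e h z He Hh Hz; apply: Rle_trans (zeta_Li_rate hb Hh) _.
have l1 := ln4_gt1 Hh; have l2 := ln4_gt1 He.
have K0 : 0 <= 4 * (2 * INR (size ks).+1 + 1) ^ (size ks).+1.
  apply: Rmult_le_pos; first lra.
  by apply: pow_le; have := pos_INR (size ks).+1; lra.
apply: Rmult_le_compat.
- by apply: Rmult_le_pos; lra.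
- by apply: pow_le; lra.
- by apply: Rmult_le_compat_l => //=; lra.
- by apply: pow_incr; rewrite /ell; lra.
Qed.

Lemma RInt_density w a b : 0 < a < 1 -> 0 < b < 1 ->
  RInt (density w) a b = prim w b - prim w a.
Proof.
move=> Ha Hb; apply: is_RInt_unique; apply: (is_RInt_derive (prim w)) => t.
  by move/(between01 Ha Hb); apply: prim_deriv.
by move/(between01 Ha Hb); apply: density_cont.
Qed.

Lemma mzv_expandable_Form1 : mzv_expandable (wcut [:: Form1]).
Proof.
apply: (@mzv_expandable_small _ (fun _ h => - ln h)); last first.
  exact: mzv_expandable_opp mzv_expandable_lnh.
(* the error is log(1 - e), and - log(1 - e) <= 1/(1-e) - 1 <= 2 e *)
exists 0%N, 2; split=> [|e h z He Hh Hz]; first lra.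
have -> : wcut [:: Form1] e h - - ln h = ln (1 - e).
  have -> : wcut [:: Form1] e h = RInt (density Form1) e (1 - h).
    by apply: RInt_ext => t _; rewrite /= Rmult_1_l.
  rewrite RInt_density; try lra.
  rewrite /prim (_ : 1 - (1 - h) = h); ring.
rewrite Rabs_left1; last by rewrite -ln_1; apply: ln_le; lra.
rewrite -ln_Rinv /= ?Rmult_1_r; last lra.
have e0 : 0 < / (1 - e) by apply: Rinv_0_lt_compat; lra.
have h1 : ln (/ (1 - e)) <= / (1 - e) - 1.
  by have := exp_ineq1_le (ln (/ (1 - e))); rewrite exp_ln //; lra.
have h2 : / (1 - e) <= 1 + 2 * e.
  apply: (Rmult_le_reg_r (1 - e)); first lra.
  rewrite Rinv_l; last lra.
  have : 0 <= e * (1 - 2 * e) by apply: Rmult_le_pos; lra.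
  lra.
lra.
Qed.

Lemma mzv_expandable_shuffle u v : mzv_expandable (wcut u) -> mzv_expandable (wcut v) ->
  mzv_expandable (fun e h => sumR (fun w => wcut w e h) (shuffle u v)).
Proof.
move=> Eu Ev; apply: mzv_expandable_ext (mzv_expandable_mul Eu Ev) => e h He Hh.
by apply: itr_shuffle; lra.
Qed.

Lemma mzv_expandable_sum T (f : T -> seq form) l :
  (forall w, List.In w l -> mzv_expandable (wcut (f w))) ->
  mzv_expandable (fun e h => sumR (fun w => wcut (f w) e h) l).
Proof.
elim: l => [|w l IH] H; first exact: mzv_expandable_const mzv_0.
by apply: mzv_expandable_add; [apply: H; left | apply: IH => v Hv; apply: H; right].
Qed.

(** The letter x can be inserted in x^k u at k + 1 places before u, all with the same result, or
    inside u. *)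
Lemma sumR_insert T (x : T) (F : seq T -> R) k u :
  sumR F (shuffle [:: x] (nseq k x ++ u)) =
  INR k.+1 * F (nseq k.+1 x ++ u) +
  sumR (fun v => F (nseq k x ++ v))
    (if u is y :: u' then map (cons y) (shuffle [:: x] u') else [::]).
Proof.
elim: k F => [|k IH] F.
  change (fun v => F (nseq 0 x ++ v)) with F.
  by case: u => [|y u] /=; ring.
rewrite [nseq k.+1 x ++ u]/= shuffle_cons sumR_cat [X in _ + X]sumR_map IH.
by rewrite [sumR F _]/= [INR k.+2]S_INR /=; ring.
Qed.

(** Shuffling dt/(1-t) with a word that has k of these letters outermost yields k + 1 copies of
    the word with k + 1 of them, and words with k of them.  The property Q is any one which is
    kept when a letter is inserted further inside; it is used with no constraint, and with the
    constraint that the innermost letter be dt/(1-t). *)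
Lemma mzv_expandable_lead (Q : seq form -> Prop) :
  (forall u v, Q (Form0 :: u) -> List.In v (shuffle [:: Form1] u) -> Q (Form0 :: v)) ->
  (forall u, Q (Form0 :: u) -> mzv_expandable (wcut (Form0 :: u))) ->
  forall k u, (if u is x :: _ then x = Form0 /\ Q u else True) ->
  mzv_expandable (wcut (nseq k Form1 ++ u)).
Proof.
move=> HQ HE; elim=> [|k IH] u Hu.
  by case: u Hu => [_|x u [-> /HE]] //; exact: mzv_expandable_const mzv_1.
apply: (@mzv_expandable_scale_inv k).
pose rest := if u is y :: u' then map (cons y) (shuffle [:: Form1] u') else [::].
apply: (@mzv_expandable_ext (fun e h =>
  sumR (fun w => wcut w e h) (shuffle [:: Form1] (nseq k Form1 ++ u))
  + - sumR (fun v => wcut (nseq k Form1 ++ v) e h) rest)).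
  by move=> e h _ _; rewrite sumR_insert -/rest; ring.
apply: mzv_expandable_add.
  by apply: mzv_expandable_shuffle; [exact: mzv_expandable_Form1 | exact: IH].
apply: mzv_expandable_opp; apply: mzv_expandable_sum => v; rewrite /rest => Hv; apply: IH.
case: u Hu @rest Hv => [|x u] //= [-> Hu] /List.in_map_iff [v' [<- Hv']].
by split=> //; apply: HQ Hv'.
Qed.

Lemma word_decomp (w : seq form) : exists k u, w = nseq k Form1 ++ u /\
  (if u is x :: _ then x = Form0 else True).
Proof.
elim: w => [|[] w [k [u [-> Hu]]]]; first by exists 0%N, [::].
  by exists 0%N, (Form0 :: nseq k Form1 ++ u).
by exists k.+1, u.
Qed.

Lemma last_insert y u v : List.In v (shuffle [:: Form1] u) ->
  last y u = Form1 -> last y v = Form1.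
Proof.
elim: u v y => [|z u IH] v y /=; first by move=> [<-|].
move=> [<- //|]; move/List.in_map_iff => [v' [<- Hv']] /=.
exact: IH.
Qed.

Lemma mzv_expandable_start w : last Form1 w = Form1 -> mzv_expandable (wcut w).
Proof.
have [k [u [-> Hu]]] := word_decomp w.
move=> Hl; apply: (@mzv_expandable_lead (fun w => last Form1 w = Form1)).
- by move=> u' v /= Hu' Hv; exact: last_insert Hv Hu'.
- by case=> [|x u'] //= Hu'; apply: mzv_expandable_convergent.
case: u Hu Hl => [|x u] // -> Hl; split=> //.
by move: Hl; rewrite last_cat.
Qed.

Definition dual (w : form) : form := if w is Form0 then Form1 else Form0.

Lemma refl_dens w : refl (dens w) = dens (dual w).
Proof.
apply: cfun_eq => t; case: w => //=; congr (/ _); ring.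
Qed.

Lemma wint_reflect a w b : 0 < a < 1 -> 0 < b < 1 ->
  wint a w b = wint (1 - b) (rev (map dual w)) (1 - a).
Proof.
move=> Ha Hb; rewrite /wint itr_reflect // map_rev -!map_comp.
by congr (itr _ (rev _) _); apply: eq_map => x /=; exact: refl_dens.
Qed.

(** Words with outermost letter dt/t are reflections of words with innermost letter dt/(1-t), the
    cut-offs being exchanged; the general case follows by a second regularization. *)
Theorem mzv_expandable_word w : mzv_expandable (wcut w).
Proof.
have E0 u : mzv_expandable (wcut (Form0 :: u)).
  have /mzv_expandable_swap : mzv_expandable (wcut (rev (map dual (Form0 :: u)))).
    by apply: mzv_expandable_start; rewrite map_cons rev_cons last_rcons.
  apply: mzv_expandable_ext => e h He Hh; rewrite /wcut [RHS]wint_reflect; try lra.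
  by congr wint; ring.
have [k [u [-> Hu]]] := word_decomp w.
by apply: (@mzv_expandable_lead (fun=> True)) => //; case: u Hu.
Qed.

(** * The algebra spanned by iterated integrals from the lower cut-off *)

Lemma RIntD (f g : R -> R) a b : ex_RInt f a b -> ex_RInt g a b ->
  RInt (fun t => f t + g t) a b = RInt f a b + RInt g a b.
Proof. exact: (@RInt_plus R_CompleteNormedModule). Qed.

Lemma RIntB (f g : R -> R) a b : ex_RInt f a b -> ex_RInt g a b ->
  RInt (fun t => f t - g t) a b = RInt f a b - RInt g a b.
Proof. exact: (@RInt_minus R_CompleteNormedModule). Qed.

Lemma RIntZ c (f : R -> R) a b : ex_RInt f a b ->
  RInt (fun t => c * f t) a b = c * RInt f a b.
Proof. by move=> ef; apply: (@RInt_scal R_CompleteNormedModule). Qed.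

(** The functions of z spanned by the iterated integrals of words from eps to z, with coefficients
    depending on the cut-offs. *)
Inductive zspan : (R -> R -> R -> R) -> Prop :=
| zspan_word w : zspan (fun e _ z => wint e w z)
| zspan_add F G : zspan F -> zspan G -> zspan (fun e h z => F e h z + G e h z)
| zspan_scale g F : mzv_expandable g -> zspan F -> zspan (fun e h z => g e h * F e h z)
| zspan_ext F G : (forall e h z, 0 < e < / 4 -> 0 < h < / 4 -> 0 < z < 1 ->
    F e h z = G e h z) -> zspan F -> zspan G.

Lemma zspan_const g : mzv_expandable g -> zspan (fun e h _ => g e h).
Proof.
move=> Eg; apply: zspan_ext (zspan_scale Eg (zspan_word [::])) => e h z *.
by rewrite /wint /= Rmult_1_r.
Qed.

Lemma zspan_sum T (f : T -> R -> R -> R -> R) l : (forall w, List.In w l -> zspan (f w)) ->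
  zspan (fun e h z => sumR (fun w => f w e h z) l).
Proof.
elim: l => [|w l IH] H; first exact: zspan_const (mzv_expandable_const mzv_0).
by apply: zspan_add; [apply: H; left | apply: IH => v Hv; apply: H; right].
Qed.

Lemma zspan_mul F G : zspan F -> zspan G -> zspan (fun e h z => F e h z * G e h z).
Proof.
move=> SF SG; elim: SF => [u|F1 F2 _ IH1 _ IH2|g F1 Eg _ IH|F1 F2 eF _ IH].
- elim: SG => [v|G1 G2 _ IH1 _ IH2|g G1 Eg _ IH|G1 G2 eG _ IH].
  + apply: (@zspan_ext (fun e _ z => sumR (fun w => wint e w z) (shuffle u v))).
      by move=> e h z *; rewrite /wint itr_shuffle //; lra.
    by apply: (zspan_sum (f := fun w e _ z => wint e w z)) => w _; exact: zspan_word.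
  + by apply: zspan_ext (zspan_add IH1 IH2) => e h z *; ring.
  + by apply: zspan_ext (zspan_scale Eg IH) => e h z *; ring.
  + by apply: zspan_ext IH => e h z *; rewrite eG.
- by apply: zspan_ext (zspan_add IH1 IH2) => e h z *; ring.
- by apply: zspan_ext (zspan_scale Eg IH) => e h z *; ring.
- by apply: zspan_ext IH => e h z *; rewrite eF.
Qed.

Lemma zspan_cont F : zspan F -> cont01 F.
Proof.
elim=> [w|F1 F2 _ IH1 _ IH2|g F1 Eg _ IH|F1 F2 eF _ IH] e h t He Hh Ht.
- by apply: itr_cont; lra.
- by apply: (continuous_plus (F1 e h)); [apply: IH1 | apply: IH2].
- by apply: (continuous_scal_r (g e h) (F1 e h)); apply: IH.
- apply: (continuous_ext_loc _ (F1 e h)); last exact: IH.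
  by apply: near01 => // s Hs; rewrite eF.
Qed.

Lemma mzv_expandable_logO g : mzv_expandable g -> logO false (fun e h _ => g e h).
Proof. by move=> [P [gP _]]; exact: log_expands_logO gP. Qed.

Lemma zspan_logO F : zspan F -> logO false F.
Proof.
elim=> [w|F1 F2 _ IH1 _ IH2|g F1 Eg _ IH|F1 F2 eF _ IH].
- exact: logO_wint.
- exact: logO_add.
- exact: (logO_mul (mzv_expandable_logO Eg)).
- by apply: logO_ext IH => e h z He Hh Hz; apply: eF => //; lra.
Qed.

Lemma zspan_top F : zspan F -> mzv_expandable (fun e h => F e h (1 - h)).
Proof.
elim=> [w|F1 F2 _ IH1 _ IH2|g F1 Eg _ IH|F1 F2 eF _ IH].
- exact: mzv_expandable_word.
- exact: mzv_expandable_add.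
- exact: mzv_expandable_mul.
- by apply: mzv_expandable_ext IH => e h He Hh; apply: eF => //; lra.
Qed.

Lemma ex_RInt_dens (f : R -> R) w a z : (forall t, 0 < t < 1 -> continuous f t) ->
  0 < a < 1 -> 0 < z < 1 -> ex_RInt (fun t => f t * density w t) a z.
Proof.
move=> cf; apply: RInt_cont01 => t Ht.
by apply: (continuous_mult f (density w)); [apply: cf | apply: density_cont].
Qed.

Lemma zspan_int F w : zspan F -> zspan (fun e h z => RInt (fun t => F e h t * density w t) e z).
Proof.
move=> SF; elim: SF (SF) => [u|F1 F2 S1 IH1 S2 IH2|g F1 Eg S1 IH|F1 F2 eF S1 IH] _.
- exact: (zspan_word (w :: u)).
- apply: zspan_ext (zspan_add (IH1 S1) (IH2 S2)) => e h z He Hh Hz.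
  rewrite -RIntD.
  + by apply: RInt_ext => t _; eqR; ring.
  + by apply: ex_RInt_dens; [move=> t; apply: zspan_cont | lra | lra].
  + by apply: ex_RInt_dens; [move=> t; apply: zspan_cont | lra | lra].
- apply: zspan_ext (zspan_scale Eg (IH S1)) => e h z He Hh Hz.
  rewrite -RIntZ.
  + by apply: RInt_ext => t _; eqR; ring.
  + by apply: ex_RInt_dens; [move=> t; apply: zspan_cont | lra | lra].
- apply: zspan_ext (IH S1) => e h z He Hh Hz; apply: RInt_ext => t Ht.
  have He1 : 0 < e < 1 by lra.
  by rewrite eF //; apply: (between01 He1 Hz); lra.
Qed.

Lemma psplits_map T U (f : T -> U) w :
  psplits (map f w) = map (fun p => (map f p.1, map f p.2)) (psplits w).
Proof. by elim: w => //= x w ->; rewrite -!map_comp. Qed.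

Lemma psplits_size T (w : seq T) p : List.In p (psplits w) -> (size p.1 < size w)%N.
Proof.
elim: w p => //= x w IH p [<- //|] /List.in_map_iff [q [<- /IH]] /=.
by rewrite ltnS.
Qed.

(** Path composition at z between the two cut-offs, by induction on the length. *)
Lemma zspan_upper w : zspan (fun _ h z => wint z w (1 - h)).
Proof.
have [n] := ubnP (size w); elim: n w => // n IH w Hw.
apply: (@zspan_ext (fun e h z => wcut w e h +
  -1 * sumR (fun p => wint z p.1 (1 - h) * wint e p.2 z) (psplits w))).
  move=> e h z He Hh Hz; rewrite /wcut /wint (@itr_path e z); try lra.
  by rewrite psplits_map sumR_map /=; ring.
apply: zspan_add; first exact: zspan_const (mzv_expandable_word w).
have E1 : mzv_expandable (fun _ _ => -1) by apply: mzv_expandable_opp (mzv_expandable_const mzv_1).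
apply: (zspan_scale E1).
apply: (zspan_sum (f := fun p e h z => wint z p.1 (1 - h) * wint e p.2 z)) => p Hp.
apply: zspan_mul; last exact: zspan_word.
by apply: IH; apply: leq_trans (psplits_size Hp) _.
Qed.

(** * Truncated polylogarithms *)

Lemma iterint_wint a b l : iterint a b (map density l) = wint a (rev l) b.
Proof. by rewrite /wint map_rev -iterint_itr -map_comp. Qed.

(** The word of an index, innermost letter first. *)
Definition kword (ks : seq nat) : seq form :=
  flatten [seq Form1 :: nseq k.-1 Form0 | k <- ks].

Lemma kword_rcons ks k : kword (rcons ks k) = kword ks ++ Form1 :: nseq k.-1 Form0.
Proof. by rewrite /kword map_rcons flatten_rcons. Qed.

Lemma starts_rcons ks k : starts (rcons ks k) = rcons (starts ks) (sumn ks).+1.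
Proof.
rewrite /starts size_rcons -[in iota _ _]addn1 iotaD map_cat -[RHS]cats1 add0n.
congr (_ ++ _); last by rewrite /= -cats1 take_size_cat.
apply/eq_in_map => j; rewrite mem_iota /= => Hj.
by rewrite -cats1 takel_cat // ltnW.
Qed.

Lemma starts_le ks i : i \in starts ks -> (i <= (sumn ks).+1)%N.
Proof.
case/mapP => j _ ->; rewrite ltnS -{2}(cat_take_drop j ks) sumn_cat; exact: leq_addr.
Qed.

Lemma nu_kword ks : all (fun k => 0 < k)%N ks ->
  [seq nu ks i | i <- iota 1 (sumn ks)] = kword ks.
Proof.
elim/last_ind: ks => [//|ks k IH]; rewrite all_rcons => /andP [k0 /IH {}IH].
rewrite sumn_rcons iotaD map_cat kword_rcons -IH; congr (_ ++ _).
  apply/eq_in_map => i; rewrite mem_iota add1n ltnS => /andP [_ Hi].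
  by rewrite /nu starts_rcons mem_rcons inE ltn_eqF.
case: k k0 => // k _ /=; rewrite add1n; congr (_ :: _).
  by rewrite /nu starts_rcons mem_rcons mem_head.
apply: (@eq_from_nth _ Form0); first by rewrite size_map size_iota size_nseq.
move=> i; rewrite size_map size_iota => Hi.
rewrite (nth_map 0%N) ?size_iota // nth_iota // nth_nseq Hi.
rewrite /nu ifN // starts_rcons mem_rcons inE negb_or; apply/andP; split.
  by rewrite gtn_eqF // addSn ltnS leq_addr.
by apply/negP => /starts_le; rewrite addSn ltnS leqNgt ltnS leq_addr.
Qed.

Lemma windex_kword ks : all (fun k => 0 < k)%N ks -> windex (rev (kword ks)) = rev ks.
Proof.
elim/last_ind: ks => [//|ks k IH]; rewrite all_rcons => /andP [k0 /IH {}IH].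
rewrite kword_rcons rev_cat rev_cons rev_rcons -cats1 -catA rev_nseq.
case: k k0 => // k _; rewrite [_.-1]/=.
by elim: k => [|k IHk] /=; rewrite ?IH ?IHk.
Qed.

Lemma last_kword ks : last Form1 (rev (kword ks)) = Form1.
Proof. by case: ks => //= k ks; rewrite /kword /= rev_cons last_rcons. Qed.

Lemma nu'_dual ks i : nu' ks i = dual (nu ks i).
Proof. by rewrite /nu /nu'; case: ifP. Qed.

Lemma dualK : involutive dual. Proof. by case. Qed.

Lemma index_pos (k : index) : all (fun k => 0 < k)%N (val k).
Proof. by case: k => ks /= /andP[]. Qed.

Lemma gen_truncE e h g z : 0 < z < 1 -> 0 < h < 1 -> gen_trunc e h g z =
  match g with
  | GenLi k => wint e (rev (kword (val k))) z
  | GenLi1 k => wint h (rev (kword (val k))) (1 - z)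
  end.
Proof.
move=> Hz Hh; case: g => k; rewrite /gen_trunc.
  by rewrite (map_comp density) iterint_wint nu_kword // index_pos.
rewrite (map_comp density) iterint_wint map_rev revK.
have -> : [seq nu' (val k) i | i <- iota 1 (sumn (val k))] = map dual (kword (val k)).
  by rewrite -nu_kword ?index_pos // -map_comp; apply: eq_map => i; exact: nu'_dual.
rewrite wint_reflect; try lra.
rewrite -map_comp (eq_map dualK) map_id; congr (wint _ _ _); ring.
Qed.

Lemma zspan_gen_trunc g : zspan (fun e h z => gen_trunc e h g z).
Proof.
case: g => k.
  apply: zspan_ext (zspan_word (rev (kword (val k)))) => e h z *.
  by rewrite gen_truncE //; lra.
apply: zspan_ext (zspan_upper (map dual (kword (val k)))) => e h z *.
rewrite [LHS]wint_reflect ?gen_truncE; try lra.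
rewrite -map_comp (eq_map dualK) map_id; congr (wint _ _ _); ring.
Qed.

(** The growth conditions are invariant under the reflection z -> 1 - z. *)
Lemma logO_sym b F : logO b F -> logO b (fun e h z => F h e (1 - z)).
Proof.
move=> [n [C [C0 HC]]]; exists n, C; split=> // e h z He Hh Hz.
have -> : logO_scale b e h = logO_scale b h e by case: b {HC} => //=; ring.
have -> : ell e h = ell h e by rewrite /ell; ring.
by apply: HC => //; lra.
Qed.

Lemma Li_word_kword (k : index) : Li_word (rev (kword (val k))) = Li (val k).
Proof.
rewrite /Li_word windex_kword ?index_pos // revK.
by case: k => [[]].
Qed.

Lemma gen_trunc_small g : logO true (fun e h z => gen_trunc e h g z - gen_fun g z).
Proof.
case: g => k; have := wint_Li_word (last_kword (val k)); rewrite Li_word_kword => H.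
  apply: logO_ext H => e h z *; rewrite gen_truncE //; lra.
apply: logO_ext (logO_sym H) => e h z *; rewrite gen_truncE //; lra.
Qed.

Lemma gen_fun_logO g : logO false (fun _ _ z => gen_fun g z).
Proof.
case: g => k; have := logO_Li_word (rev (kword (val k))); rewrite Li_word_kword //.
exact: logO_sym.
Qed.

Lemma Li_cont (k : index) z : 0 < z < 1 -> continuous (Li (val k)) z.
Proof. by move=> Hz; rewrite -Li_word_kword; apply: Li_word_cont => //; exact: last_kword. Qed.

Lemma gen_fun_cont g z : 0 < z < 1 -> continuous (gen_fun g) z.
Proof.
move=> Hz; case: g => k; first exact: Li_cont.
apply: (continuous_comp (fun t => 1 - t)).
  apply: (continuous_minus (fun=> 1)); [exact: continuous_const | exact: continuous_id].
by apply: Li_cont; lra.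
Qed.

Lemma mono_fun_cons g m z : mono_fun (g :: m) z = gen_fun g z * mono_fun m z.
Proof. by rewrite /mono_fun big_cons. Qed.
Lemma mono_trunc_cons e h g m z :
  mono_trunc e h (g :: m) z = gen_trunc e h g z * mono_trunc e h m z.
Proof. by rewrite /mono_trunc big_cons. Qed.

Lemma mono_fun_nil z : mono_fun [::] z = 1.
Proof. by rewrite /mono_fun big_nil. Qed.
Lemma mono_trunc_nil e h z : mono_trunc e h [::] z = 1.
Proof. by rewrite /mono_trunc big_nil. Qed.

Lemma zspan_mono m : zspan (fun e h z => mono_trunc e h m z).
Proof.
elim: m => [|g m IH].
  apply: zspan_ext (zspan_const (mzv_expandable_const mzv_1)) => e h z *; by rewrite mono_trunc_nil.
by apply: zspan_ext (zspan_mul (zspan_gen_trunc g) IH) => e h z *; rewrite mono_trunc_cons.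
Qed.

Lemma mono_fun_cont m z : 0 < z < 1 -> continuous (mono_fun m) z.
Proof.
move=> Hz; elim: m => [|g m IH].
  apply: (continuous_ext (fun=> 1)); last exact: continuous_const.
  by move=> x; rewrite mono_fun_nil.
apply: (continuous_ext (fun z => gen_fun g z * mono_fun m z)).
  by move=> x; rewrite mono_fun_cons.
by apply: (continuous_mult (gen_fun g)) IH; exact: gen_fun_cont.
Qed.

Lemma mono_fun_logO m : logO false (fun _ _ z => mono_fun m z).
Proof.
elim: m => [|g m IH].
  by apply: logO_ext (logO_const 1) => e h z *; rewrite mono_fun_nil.
by apply: logO_ext (logO_mul (gen_fun_logO g) IH) => e h z *; rewrite mono_fun_cons.
Qed.

Lemma mono_trunc_small m : logO true (fun e h z => mono_trunc e h m z - mono_fun m z).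
Proof.
elim: m => [|g m IH].
  by apply: logO_ext (logO_0 _) => e h z *; rewrite mono_fun_nil mono_trunc_nil; ring.
apply: logO_ext (logO_add (logO_mul (gen_trunc_small g) (mono_fun_logO m))
  (logO_mul IH (zspan_logO (zspan_gen_trunc g)))) => e h z *.
rewrite mono_fun_cons mono_trunc_cons; ring.
Qed.

(** * Truncated and exact integrals of monomials *)

Lemma iterint_rcons a b gs g :
  iterint a b (rcons gs g) = RInt (fun t => iterint a t gs * g t) a b.
Proof. by rewrite /iterint foldl_rcons. Qed.

Lemma letter_cont (f : R -> R) w : (forall t, 0 < t < 1 -> continuous f t) ->
  forall t, 0 < t < 1 -> continuous (fun z => f z * density w z) t.
Proof.
move=> cf t Ht; apply: (continuous_mult f (density w)); first exact: cf.
exact: density_cont.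
Qed.

Section Letters.
Variables (I : Type) (om : I -> form).

Lemma iterint_cont (f : I -> R -> R) l a b :
  (forall i t, 0 < t < 1 -> continuous (f i) t) -> 0 < a < 1 -> 0 < b < 1 ->
  continuous (fun b => iterint a b [seq (fun z => f i z * density (om i) z) | i <- l]) b.
Proof.
move=> cfi Ha Hb; pose phi i := Cfun (letter_cont (w := om i) (cfi i)).
apply: (continuous_ext (itr a (rev (map phi l)))); last exact: itr_cont.
by move=> x; rewrite -iterint_itr -map_comp.
Qed.

Lemma iterint_ext (f g : I -> R -> R) l a b :
  (forall i t, 0 < t < 1 -> f i t = g i t) -> 0 < a < 1 -> 0 < b < 1 ->
  iterint a b [seq (fun z => f i z * density (om i) z) | i <- l] =
  iterint a b [seq (fun z => g i z * density (om i) z) | i <- l].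
Proof.
move=> fg Ha; elim/last_ind: l b => [//|l i IH] b Hb.
rewrite !map_rcons !iterint_rcons; apply: RInt_ext => t Ht.
have Ht1 : 0 < t < 1 by apply: (between01 Ha Hb); lra.
by rewrite IH // fg.
Qed.

Variable m : I -> monomial.

Lemma zspan_iterint l : zspan (fun e h z =>
  iterint e z [seq (fun z => mono_trunc e h (m i) z * density (om i) z) | i <- l]).
Proof.
elim/last_ind: l => [|l i IH]; first exact: (zspan_word [::]).
apply: zspan_ext (zspan_int (om i) (zspan_mul IH (zspan_mono (m i)))) => e h z He Hh Hz.
rewrite map_rcons iterint_rcons; apply: RInt_ext => t _; eqR; ring.
Qed.

(** In each letter the difference T t - X x of truncated and exact integrands is
    (T - X) x + (t - x) T, where one factor is small and the other one grows logarithmically. *)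
Lemma iterint_small l : logO true (fun e h z =>
  iterint e z [seq (fun z => mono_trunc e h (m i) z * density (om i) z) | i <- l] -
  iterint e z [seq (fun z => mono_fun (m i) z * density (om i) z) | i <- l]).
Proof.
elim/last_ind: l => [|l i IH].
  by apply: logO_ext (logO_0 _) => e h z *; rewrite /iterint /=; ring.
pose Tr e h z := iterint e z [seq (fun z => mono_trunc e h (m i) z * density (om i) z) | i <- l].
pose Ex (e h z : R) := iterint e z [seq (fun z => mono_fun (m i) z * density (om i) z) | i <- l].
have cT : cont01 (fun e h z => Tr e h z * mono_trunc e h (m i) z).
  exact: zspan_cont (zspan_mul (zspan_iterint l) (zspan_mono (m i))).
have cE : cont01 (fun e h z => Ex e h z * mono_fun (m i) z).
  move=> e h t He Hh Ht; apply: (continuous_mult (Ex e h)); last exact: mono_fun_cont.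
  by apply: iterint_cont; [move=> *; exact: mono_fun_cont | lra | lra].
have B : logO true (fun e h z => Tr e h z * mono_trunc e h (m i) z - Ex e h z * mono_fun (m i) z).
  apply: logO_ext (logO_add (logO_mul IH (mono_fun_logO (m i)))
    (logO_mul (mono_trunc_small (m i)) (zspan_logO (zspan_iterint l)))) => e h z *.
  rewrite /Tr /Ex; ring.
apply: logO_ext (logO_int (om i) _ B) => [e h z He Hh Hz|]; last first.
  move=> e h t He Hh Ht; apply: (continuous_minus (fun z => Tr e h z * mono_trunc e h (m i) z)).
    exact: cT.
  exact: (cE e h).
rewrite !map_rcons !iterint_rcons -RIntB.
- by apply: RInt_ext => t _; eqR; rewrite /Tr /Ex; ring.
- apply: (ex_RInt_ext (fun t => (Tr e h t * mono_trunc e h (m i) t) * density (om i) t)).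
    by move=> t _; rewrite /Tr; eqR; ring.
  by apply: ex_RInt_dens; [move=> t; apply: cT | lra | lra].
- apply: (ex_RInt_ext (fun t => (Ex e h t * mono_fun (m i) t) * density (om i) t)).
    by move=> t _; rewrite /Ex; eqR; ring.
  by apply: ex_RInt_dens; [move=> t; apply: (cE e h) | lra | lra].
Qed.
End Letters.

Lemma mzv_expandable_Icut_mono N (m : 'I_N -> monomial) om :
  mzv_expandable (fun e h => Icut_mono e h m om).
Proof. exact: zspan_top (zspan_iterint om m (enum 'I_N)). Qed.

Lemma Icut_mono_small N (m : 'I_N -> monomial) om :
  logO true (fun e h _ => Icut_mono e h m om - Icut e h (fun i => mono_fun (m i)) om).
Proof.
have := iterint_small om m (enum 'I_N).
by move/(logO_at (p := fun _ h => 1 - h) ltac:(move=> *; lra)).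
Qed.

(** * Uniqueness of expansions *)

Definition ray_h (n : nat) : R := exp (- INR n.+1).
Definition ray_e (c : R) (n : nat) : R := exp (c - INR n.+1).

(** The error term allowed in [log_expansion]. *)
Definition log_small (G : R -> R -> R) := exists A C delta : R, 0 < delta /\
  forall e h, 0 < e < delta -> 0 < h < delta ->
    Rabs (G e h) <= C * ((e + h) * Rpower (Rabs (ln e) + Rabs (ln h)) A).

Lemma exp_pow x n : exp x ^ n = exp (INR n * x).
Proof.
elim: n => [|n IH]; first by rewrite Rmult_0_l exp_0.
rewrite -tech_pow_Rmult IH -exp_plus S_INR; congr exp; ring.
Qed.

(** From 1 + y <= exp y at y = x / (k+1). *)
Lemma pow_exp_bound x k : 0 <= x -> x ^ k.+1 <= INR k.+1 ^ k.+1 * exp x.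
Proof.
move=> x0; have k0 := INR_gt0 k.
have h1 : x / INR k.+1 <= exp (x / INR k.+1).
  by have := exp_ineq1_le (x / INR k.+1); lra.
have h2 : 0 <= x / INR k.+1 by apply: Rmult_le_pos => //; apply/Rlt_le/Rinv_0_lt_compat.
have h3 := pow_incr _ _ k.+1 (conj h2 h1).
have -> : x ^ k.+1 = INR k.+1 ^ k.+1 * (x / INR k.+1) ^ k.+1.
  by rewrite -Rpow_mult_distr; congr pow; field; lra.
apply: Rmult_le_compat_l; first by apply: pow_le; lra.
apply: Rle_trans h3 _; rewrite exp_pow; right; congr exp; field; lra.
Qed.

Lemma eventually_INR B : eventually (fun n => B < INR n.+1).
Proof.
have [N HN] : eventually (fun n => B < INR n) by apply: is_lim_seq_INR; exists B.
by exists N => n Hn; apply: HN; apply: le_S.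
Qed.

Lemma lim_inv_INR D : is_lim_seq (fun n => D / INR n.+1) 0.
Proof.
have -> : Rbar.Finite 0 = Rbar_mult (Rbar.Finite D) (Rbar.Finite 0) by rewrite /= Rmult_0_r.
apply: is_lim_seq_scal_l.
have H := is_lim_seq_inv INR p_infty is_lim_seq_INR ltac:(discriminate).
by move/is_lim_seq_incr_1: H.
Qed.

Lemma log_small_ray G c : log_small G ->
  is_lim_seq (fun n => G (ray_e c n) (ray_h n)) 0.
Proof.
move=> [A [C [delta [d0 H]]]].
have [k Hk] : exists k, A <= INR k.
  by have [k Hk] := INR_unbounded A; exists k; lra.
(* along the ray, with x = - log eta, the bound is of the order of exp(-x) x^k = O(1/x) *)
pose D := Rabs C * (exp c + 1) * 3 ^ k * INR k.+1 ^ k.+1.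
have Ev : eventually (fun n => Rabs (G (ray_e c n) (ray_h n)) <= D / INR n.+1).
  have E1 := eventually_INR (- ln delta).
  have E2 := eventually_INR (c - ln delta).
  have E3 := eventually_INR (Rabs c).
  apply: filter_imp (filter_and _ _ E1 (filter_and _ _ E2 E3)) => n [h1 [h2 h3]].
  set x := INR n.+1 in h1 h2 h3 *.
  have x1 : 1 <= x by rewrite /x S_INR; have := pos_INR n; lra.
  have le : ln (ray_e c n) = c - x by rewrite ln_exp.
  have lh : ln (ray_h n) = - x by rewrite ln_exp.
  have Hh : 0 < ray_h n < delta.
    split; first exact: exp_pos.
    by rewrite -[delta]exp_ln //; apply: exp_increasing; rewrite -/x; lra.
  have He : 0 < ray_e c n < delta.
    split; first exact: exp_pos.
    by rewrite -[delta]exp_ln //; apply: exp_increasing; rewrite -/x; lra.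
  apply: Rle_trans (H _ _ He Hh) _; rewrite le lh.
  set L := Rabs (c - x) + Rabs (- x).
  have Lx : 1 <= L <= 3 * x.
    rewrite /L [Rabs (- x)]Rabs_left; last lra.
    have := Rabs_pos (c - x); have := Rabs_triang c (- x).
    rewrite [Rabs (- x)]Rabs_left; last lra.
    by rewrite -/(c - x); lra.
  have RL : Rpower L A <= (3 * x) ^ k.
    apply: Rle_trans (_ : Rpower L (INR k) <= _).
      by apply: Rle_Rpower; lra.
    by rewrite Rpower_pow; [apply: pow_incr; lra | lra].
  have R0 : 0 < Rpower L A by apply: exp_pos.
  have ee : ray_e c n + ray_h n = (exp c + 1) * exp (- x).
    by rewrite /ray_e /ray_h -/x exp_plus; ring.
  have ex0 := exp_pos (- x); have ec0 := exp_pos c.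
  have p0 : 0 < (exp c + 1) * exp (- x) by apply: Rmult_lt_0_compat; lra.
  have xk : x ^ k <= INR k.+1 ^ k.+1 * exp x / x.
    apply: (Rmult_le_reg_l x); first lra.
    rewrite tech_pow_Rmult; have := pow_exp_bound k (x := x) ltac:(lra).
    by move/Rle_trans; apply; right; field; lra.
  rewrite ee; apply: Rle_trans (_ : Rabs C * ((exp c + 1) * exp (- x) * Rpower L A) <= _).
    by apply: Rmult_le_compat_r; [apply: Rmult_le_pos; lra | apply: Rle_abs].
  have -> : D / x = Rabs C * ((exp c + 1) * exp (- x) * (3 ^ k * (INR k.+1 ^ k.+1 * exp x / x))).
    have e1 : exp (- x) * exp x = 1 by rewrite -exp_plus Rplus_opp_l exp_0.
    rewrite /D.
    transitivity (Rabs C * (exp c + 1) * 3 ^ k * INR k.+1 ^ k.+1 / x * (exp (- x) * exp x)).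
      by rewrite e1 Rmult_1_r.
    field; lra.
  apply: Rmult_le_compat_l; first exact: Rabs_pos.
  apply: Rmult_le_compat_l; first lra.
  apply: Rle_trans RL _; rewrite Rpow_mult_distr.
  by apply: Rmult_le_compat_l => //; apply: pow_le; lra.
apply: (@is_lim_seq_le_le_loc (fun n => - D / INR n.+1) _ (fun n => D / INR n.+1)).
- apply: filter_imp Ev => n Hn; move/Rabs_le_between: Hn.
  by rewrite /Rdiv Ropp_mult_distr_l_reverse -/(D / INR n.+1).
- exact: lim_inv_INR.
- exact: lim_inv_INR.
Qed.

Lemma poly_infinite_roots (T : idomainType) (p : {poly T}) (f : nat -> T) :
  injective f -> (forall n, p.[f n] = 0)%R -> p = 0%R.
Proof.
move=> fI pf; apply/eqP/negP => /negP p0.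
have := @max_poly_roots _ p (mkseq f (size p)) p0.
rewrite size_mkseq ltnn mkseq_uniq // => H.
have // : false by apply: H => //; apply/allP => x /mapP [n _ ->]; rewrite rootE pf.
Qed.

(** Writing Q as X Q' + c, division by X shows that Q' tends to 0 as well, and c with it. *)
Lemma poly_seq0 (Q : {poly R}) :
  is_lim_seq (fun n => (Q.[- INR n.+1])%R) 0 -> Q = 0%R.
Proof.
elim/poly_ind: Q => [//|Q c IH] H.
have H1 : is_lim_seq (fun n => (Q.[- INR n.+1])%R) 0.
  apply: (is_lim_seq_ext (fun n => (c - ((Q * 'X + c%:P).[- INR n.+1])%R) * / INR n.+1)).
    move=> n; rewrite hornerMXaddC.
    change ((c - (Q.[- INR n.+1]%R * - INR n.+1 + c)) * / INR n.+1 = Q.[- INR n.+1]%R).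
    by field; have := INR_gt0 n; lra.
  have -> : Rbar.Finite 0 = Rbar_mult (Rbar.Finite (c - 0)) (Rbar.Finite 0) by rewrite /= Rmult_0_r.
  apply: is_lim_seq_mult'.
    by apply: is_lim_seq_minus' => //; exact: is_lim_seq_const.
  apply: is_lim_seq_ext (lim_inv_INR 1) => n; rewrite /Rdiv; ring.
move: H; rewrite (IH H1) mul0r add0r => H.
have := is_lim_seq_unique _ _ H.
rewrite (Lim_seq_ext _ (fun=> c)); last by move=> n; rewrite hornerC.
by rewrite Lim_seq_const => -[->]; rewrite polyC0.
Qed.

(** On the ray eps = exp(c) eta, the polynomial becomes one in the single variable log eta. *)
Theorem eval2_ray0 P :
  (forall c, is_lim_seq (fun n => eval2 P (ln (ray_e c n)) (ln (ray_h n))) 0) ->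
  P = 0%R.
Proof.
move=> H.
have H1 c y : eval2 P (y + c) y = 0.
  pose Q : {poly R} := (P.['X + c%:P])%R.
  have QE x : (Q.[x])%R = eval2 P (x + c) x.
    rewrite /Q /eval2.
    elim/poly_ind: P {H Q} => [|P c' IH]; first by rewrite !horner0.
    by rewrite !(hornerD, hornerM, hornerX, hornerC) IH.
  have Q0 : Q = 0%R.
    apply: poly_seq0; apply: is_lim_seq_ext (H c) => n.
    by rewrite QE !ln_exp; rewrite -RoppE; congr eval2; ring.
  by have := QE y; rewrite Q0 horner0.
have INR_inj : injective INR by move=> n k /INR_eq.
apply: (@poly_infinite_roots _ _ (fun n => (INR n)%:P)%R).
  by move=> n k /polyC_inj /INR_inj.
move=> n; apply: (poly_infinite_roots INR_inj) => k.
by have := H1 (INR n - INR k) (INR k); rewrite (_ : _ + _ = INR n) //; ring.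
Qed.

Lemma logO_log_small G : logO true (fun e h _ => G e h) -> log_small G.
Proof.
move=> [n [C [C0 HC]]]; exists (INR n), C, (/ 4); split; first lra.
move=> e h He Hh; have := HC e h e He Hh ltac:(lra).
have := ln4_gt1 He; have := ln4_gt1 Hh => h1 h2.
rewrite /= Rmult_assoc [Rabs (ln e)]Rabs_left ?[Rabs (ln h)]Rabs_left; try lra.
by rewrite Rpower_pow; [ | lra].
Qed.

Lemma eval2B P Q x y : eval2 (P - Q)%R x y = eval2 P x y - eval2 Q x y.
Proof. by rewrite /eval2 !(hornerD, hornerN). Qed.

(** Stated with a limit along rays only, so that it applies to the error terms of both kinds and
    to convergent integrals. *)
Lemma ray_log_expands g P Q :
  (forall c, is_lim_seq (fun n =>
     g (ray_e c n) (ray_h n) - eval2 Q (ln (ray_e c n)) (ln (ray_h n))) 0) ->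
  log_expands g P -> P = Q.
Proof.
move=> HQ /logO_log_small HP; apply/eqP; rewrite -subr_eq0; apply/eqP.
apply: eval2_ray0 => c.
have := is_lim_seq_minus' _ _ _ _ (HQ c) (log_small_ray c HP).
rewrite Rminus_0_r; apply: is_lim_seq_ext => n.
by rewrite eval2B; ring.
Qed.

Lemma log_expands_unique g P Q : log_expands g P -> log_expands g Q -> P = Q.
Proof.
by move=> HP HQ; apply: ray_log_expands HP => c; exact: log_small_ray (logO_log_small HQ).
Qed.

Lemma log_expansionP N (m : 'I_N -> monomial) om P :
  log_expands (fun e h => Icut_mono e h m om) P ->
  log_expansion m om P /\ forall Q, log_expansion m om Q -> P = Q.
Proof.
move=> HP; split; first exact: logO_log_small HP.
move=> Q HQ; apply: ray_log_expands HP => c.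
exact: (log_small_ray (G := fun e h => Icut_mono e h m om - eval2 Q (ln e) (ln h)) c HQ).
Qed.

Lemma Ireg_monoE N (m : 'I_N -> monomial) om P :
  log_expands (fun e h => Icut e h (fun i => mono_fun (m i)) om) P ->
  Ireg_mono m om = eval2 P 0 0.
Proof.
move=> HP; have [HQ Hu] := log_expansionP (log_expands_small (Icut_mono_small m om) HP).
rewrite /Ireg_mono; case: xgetP => [Q _ /Hu <- //|H].
by case: (H P).
Qed.

Lemma mzv_expandable_Icut N (m : 'I_N -> monomial) om :
  mzv_expandable (fun e h => Icut e h (fun i => mono_fun (m i)) om).
Proof.
apply: mzv_expandable_small (mzv_expandable_Icut_mono m om).
apply: logO_ext (logO_opp (Icut_mono_small m om)) => e h z *; ring.
Qed.

(** * Shuffles as permutations *)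

Lemma mem_shuffle (T : eqType) (u v w : seq T) : uniq (u ++ v) ->
  (w \in shuffle u v) = [&& perm_eq w (u ++ v), subseq u w & subseq v w].
Proof.
elim: u v w => [|x u IHu] v w.
  move=> _; rewrite mem_seq1 sub0seq /=; apply/eqP/andP => [->|[/perm_size s1 s2]].
    by rewrite perm_refl subseq_refl.
  by apply/esym/eqP; rewrite -(size_subseq_leqif s2) s1.
elim: v w => [|y v IHv] w.
  move=> _; rewrite shuffle0r mem_seq1 cats0 sub0seq andbT.
  apply/eqP/andP => [->|[/perm_size s1 s2]]; first by rewrite perm_refl subseq_refl.
  by apply/esym/eqP; rewrite -(size_subseq_leqif s2) s1.
move=> Hu; have Hu1 : uniq (u ++ y :: v) by case/andP: Hu.
have Hu2 : uniq ((x :: u) ++ v).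
  by apply: subseq_uniq Hu; exact: cat_subseq (subseq_refl _) (subseq_cons _ _).
have xy : (x == y) = false.
  by apply/eqP => e; move: Hu; rewrite e cat_cons cons_uniq mem_cat mem_head orbT.
have pxy z w' : perm_eq (z :: w') ((x :: u) ++ y :: v) ->
  [/\ z = x -> perm_eq w' (u ++ y :: v), z = y -> perm_eq w' ((x :: u) ++ v),
    z \in (x :: u) ++ y :: v & z \notin w'].
  move=> H; split.
  - by move=> e; move: H; rewrite e cat_cons perm_cons.
  - by move=> e; move: H; rewrite e -[y :: v]cat1s perm_sym perm_catCA perm_cons perm_sym.
  - by rewrite -(perm_mem H) mem_head.
  - by move: (perm_uniq H); rewrite Hu => /andP[].
rewrite shuffle_cons mem_cat; apply/orP/and3P.
- case=> /mapP [w' Hw' ->].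
  + move: Hw'; rewrite IHu // => /and3P [h1 h2 h3]; split.
    * by rewrite cat_cons perm_cons.
    * by rewrite /= eqxx.
    * exact: subseq_trans h3 (subseq_cons _ _).
  + move: Hw'; rewrite IHv // => /and3P [h1 h2 h3]; split.
    * by rewrite -[y :: v]cat1s perm_sym perm_catCA perm_cons perm_sym.
    * exact: subseq_trans h2 (subseq_cons _ _).
    * by rewrite /= eqxx.
- case: w => [|z w'] [h1 h2 h3]; first by move/perm_size: h1.
  have [p1 p2 p3 p4] := pxy _ _ h1.
  have [e|zx] := eqVneq z x.
    left; rewrite e; apply: map_f; rewrite IHu // p1 //=.
    by move: h2 h3; rewrite e /= eqxx eq_sym xy => -> ->.
  have [e|zy] := eqVneq z y.
    right; rewrite e; apply: map_f; rewrite IHv // p2 //=.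
    by move: h2 h3; rewrite e /= eqxx xy => -> ->.
  (* a first letter z different from x and y occurs in u or v, hence a second time in w' *)
  case/negP: p4; move: p3; rewrite mem_cat => /orP [].
    by apply: mem_subseq; move: h2; rewrite /= eq_sym (negbTE zx).
  by apply: mem_subseq; move: h3; rewrite /= eq_sym (negbTE zy).
Qed.

Lemma uniq_shuffle (T : eqType) (u v : seq T) : uniq (u ++ v) -> uniq (shuffle u v).
Proof.
elim: u v => [//|x u IHu]; elim=> [//|y v IHv] Hu.
have Hu1 : uniq (u ++ y :: v) by case/andP: Hu.
have Hu2 : uniq ((x :: u) ++ v).
  by apply: subseq_uniq Hu; exact: cat_subseq (subseq_refl _) (subseq_cons _ _).
have xy : x != y.
  by apply/eqP => e; move: Hu; rewrite e cat_cons cons_uniq mem_cat mem_head orbT.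
rewrite shuffle_cons cat_uniq !map_inj_uniq ?IHu ?IHv //=; try by move=> ? ? [].
rewrite andbT; apply/hasPn => w /mapP [w' _ ->]; apply/mapP => -[w'' _ [e _]].
by rewrite e eqxx in xy.
Qed.

(** The order in which the letters appear in the term of the permutation s in the shuffle
    formula. *)
Definition pword n (s : {perm 'I_n}) : seq 'I_n := [seq (s^-1)%g i | i <- enum 'I_n].

Lemma pword_uniq n (s : {perm 'I_n}) : uniq (pword s).
Proof. by rewrite map_inj_uniq ?enum_uniq //; exact: perm_inj. Qed.

Lemma mem_pword n (s : {perm 'I_n}) i : i \in pword s.
Proof. by apply/mapP; exists (s i); rewrite ?mem_enum ?permK. Qed.

Lemma enum_ord_sorted n : sorted (fun i j : 'I_n => i < j)%N (enum 'I_n).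
Proof.
have := iota_ltn_sorted 0 n; rewrite -val_enum_ord sorted_map.
by apply: sub_sorted.
Qed.

Lemma pword_sorted n (s : {perm 'I_n}) :
  sorted (fun a b => s a < s b)%N (pword s).
Proof.
rewrite sorted_map; apply: sub_sorted (enum_ord_sorted n) => i j /=.
by rewrite !permKV.
Qed.

Lemma pword_inj n : injective (@pword n).
Proof.
move=> s t st; apply: invg_inj; apply/permP => i.
by move/eq_in_map: st => /(_ i); rewrite mem_enum; apply.
Qed.

Lemma pword_surj n (w : seq 'I_n) : uniq w -> size w = n -> exists s, w = pword s.
Proof.
case: n w => [|n] w Hw Hs.
  by exists 1%g; case: w Hs {Hw} => // _; rewrite /pword; case: (enum _) (size_enum_ord 0).
pose f (i : 'I_n.+1) := nth ord0 w i.
have fI : injective f.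
  move=> i j /eqP; rewrite /f nth_uniq ?Hs // => /eqP; exact: val_inj.
exists ((perm fI)^-1)%g; rewrite /pword invgK.
apply: (@eq_from_nth _ ord0); first by rewrite size_map size_enum_ord.
move=> i; rewrite Hs => Hi; rewrite (nth_map ord0) ?size_enum_ord // permE /f.
by rewrite nth_enum_ord.
Qed.

(** Words listing all the letters are sorted by s, and a subsequence of a sorted list is the same
    as a sorted list of its elements. *)
Lemma subseq_pword n k (s : {perm 'I_n}) (g : 'I_k -> 'I_n) :
  subseq [seq g i | i <- enum 'I_k] (pword s) =
  [forall i : 'I_k, forall j : 'I_k, (i < j)%N ==> (s (g i) < s (g j))%N].
Proof.
pose r (a b : 'I_n) := (s a < s b)%N.
have rT : transitive r by move=> b a c; exact: ltn_trans.
have rI : irreflexive r by move=> a; exact: ltnn.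
have -> : subseq [seq g i | i <- enum 'I_k] (pword s) = sorted r [seq g i | i <- enum 'I_k].
  apply/idP/idP => H; first exact: (@subseq_sorted _ r rT _ _ H (pword_sorted s)).
  have -> : [seq g i | i <- enum 'I_k] =
     [seq a <- pword s | a \in [seq g i | i <- enum 'I_k]].
    apply: (irr_sorted_eq rT rI) => //.
      exact: sorted_filter rT _ _ (pword_sorted s).
    by move=> a; rewrite mem_filter mem_pword andbT.
  exact: filter_subseq.
rewrite sorted_map; apply/idP/forallP => [H i|H].
  apply/forallP => j; apply/implyP => ij.
  have rT' : transitive (relpre g r) by move=> b a c; exact: rT.
  move: H; rewrite (sorted_pairwise rT') => /(pairwiseP i) /(_ i j).
  rewrite !inE size_enum_ord !nth_ord_enum; exact.
apply: sub_sorted (enum_ord_sorted k) => i j ij.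
by move/forallP: (H i) => /(_ j) /implyP; apply.
Qed.

(** The lists are reversed because words are written outermost letter first. *)
Lemma shuffle_perms N M :
  perm_eq (shuffle (rev [seq lshift M i | i <- enum 'I_N]) (rev [seq rshift N i | i <- enum 'I_M]))
    [seq rev (pword s) | s <- enum (fun s : {perm 'I_(N + M)} => is_shuffle s)].
Proof.
set u := map _ _; set v := map _ _.
have Huv : uniq (rev u ++ rev v).
  rewrite cat_uniq !rev_uniq (map_inj_uniq (@lshift_inj _ _)) (map_inj_uniq (@rshift_inj _ _)).
  rewrite !enum_uniq andbT; apply/hasPn => a; rewrite !mem_rev => /mapP [i _ ->].
  by apply/mapP => -[j _ /eqP]; rewrite eq_rlshift.
apply: uniq_perm; first exact: uniq_shuffle.
  by rewrite map_inj_uniq ?enum_uniq // => s t /(can_inj revK) /pword_inj.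
move=> w; rewrite mem_shuffle //.
have sh s : is_shuffle s = subseq (rev u) (rev (pword s)) && subseq (rev v) (rev (pword s)).
  by rewrite !subseq_rev !subseq_pword.
apply/and3P/mapP => [[h1 h2 h3]|[s]].
  have [s es] : exists s, rev w = pword s.
    apply: pword_surj; first by rewrite rev_uniq (perm_uniq h1).
    rewrite size_rev (perm_size h1) size_cat !size_rev.
    by rewrite (size_map (lshift M)) (size_map (@rshift N M)) !size_enum_ord.
  have {es} ew : w = rev (pword s) by rewrite -es revK.
  by exists s => //; rewrite mem_enum unfold_in sh -ew h2 h3.
rewrite mem_enum unfold_in sh => /andP [h2 h3] ->; split=> //.
apply: uniq_perm => //; first by rewrite rev_uniq pword_uniq.
move=> a; rewrite mem_rev mem_pword mem_cat !mem_rev; apply/esym.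
by case: (splitP a) => i ei; apply/orP; [left|right]; apply/mapP; exists i;
  rewrite ?mem_enum //; apply: val_inj.
Qed.

(** * Multilinearity *)

Lemma is_derive_bigsum (T : Type) (r : seq T) (F : T -> R -> R) (d : T -> R) z :
  (forall x, is_derive (F x) z (d x)) ->
  is_derive (fun z => (\sum_(x <- r) F x z)%R) z (\sum_(x <- r) d x)%R.
Proof.
move=> H; rewrite -sumR_big.
by apply: is_derive_ext (sumR_deriv r H) => t; rewrite sumR_big.
Qed.

Lemma continuous_bigsum (T : Type) (r : seq T) (F : T -> R -> R) z :
  (forall x, continuous (F x) z) -> continuous (fun z => (\sum_(x <- r) F x z)%R) z.
Proof.
move=> H; elim: r => [|x r IH].
  apply: (continuous_ext (fun=> 0)); last exact: continuous_const.
  by move=> t; rewrite big_nil.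
apply: (continuous_ext (fun z => F x z + (\sum_(x <- r) F x z)%R)).
  by move=> t; rewrite big_cons.
by apply: (continuous_plus (F x)).
Qed.

(** Choosing a term for each of N + 1 letters amounts to choosing for the first N and for the
    last one, which is integrated last. *)
Definition ext_ffun N (T : Type) (J : {ffun 'I_N -> T}) (j : T) : {ffun 'I_N.+1 -> T} :=
  [ffun i => oapp J j (unlift ord_max i)].

Lemma ext_ffun_max N T (J : {ffun 'I_N -> T}) j : ext_ffun J j ord_max = j.
Proof. by rewrite ffunE unlift_none. Qed.

Lemma widen_lift N (i : 'I_N) : widen_ord (leqnSn N) i = lift ord_max i.
Proof. exact/val_inj/esym/lift_max. Qed.

Lemma ext_ffun_widen N T (J : {ffun 'I_N -> T}) j i :
  ext_ffun J j (widen_ord (leqnSn N) i) = J i.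
Proof. by rewrite ffunE widen_lift liftK. Qed.

Lemma big_ext_ffun N (T : finType) (F : {ffun 'I_N.+1 -> T} -> R) :
  (\sum_J F J = \sum_(J : {ffun 'I_N -> T}) \sum_j F (ext_ffun J j))%R.
Proof.
rewrite pair_bigA /= (reindex (fun p => ext_ffun p.1 p.2)) //=.
exists (fun J => ([ffun i => J (widen_ord (leqnSn N) i)], J ord_max)).
  move=> [J j] _ /=; rewrite ext_ffun_max; congr pair.
  by apply/ffunP => i; rewrite ffunE ext_ffun_widen.
move=> J _; apply/ffunP => i /=; rewrite ffunE.
case: unliftP => [k ->|-> //] /=.
by rewrite ffunE widen_lift.
Qed.

Lemma iterint_deriv (I : Type) (om : I -> form) (f : I -> R -> R) l i a b :
  (forall i t, 0 < t < 1 -> continuous (f i) t) -> 0 < a < 1 -> 0 < b < 1 ->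
  is_derive (fun b => iterint a b [seq (fun z => f i z * density (om i) z) | i <- rcons l i]) b
   (iterint a b [seq (fun z => f i z * density (om i) z) | i <- l] * (f i b * density (om i) b)).
Proof.
move=> cf Ha Hb.
pose h t := iterint a t [seq (fun z => f i z * density (om i) z) | i <- l] *
  (f i t * density (om i) t).
apply: (is_derive_ext (fun b => RInt h a b)).
  by move=> t; rewrite map_rcons iterint_rcons.
apply: RInt_deriv01 => // t Ht.
apply: (continuous_mult (fun t => iterint a t _) (fun t => f i t * density (om i) t)).
  exact: iterint_cont.
exact: letter_cont (cf i) t Ht.
Qed.

Lemma map_enum_ordSr (T : Type) N (F : 'I_N.+1 -> T) :
  [seq F i | i <- enum 'I_N.+1] =
  rcons [seq F (widen_ord (leqnSn N) i) | i <- enum 'I_N] (F ord_max).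
Proof. by rewrite enum_ordSr map_rcons -map_comp. Qed.

Lemma iterint_multilinear N K (c : 'I_N -> 'I_K -> R) (g : 'I_N -> 'I_K -> R -> R) om a b :
  (forall i j t, 0 < t < 1 -> continuous (g i j) t) -> 0 < a < 1 -> 0 < b < 1 ->
  iterint a b [seq (fun z => (\sum_j c i j * g i j z)%R * density (om i) z) | i <- enum 'I_N] =
  (\sum_(J : {ffun 'I_N -> 'I_K}) (\prod_i c i (J i)) *
    iterint a b [seq (fun z => g i (J i) z * density (om i) z) | i <- enum 'I_N])%R.
Proof.
move=> cg Ha; elim: N c g om cg b => [|N IH] c g om cg b Hb.
  have e0 (F : 'I_0 -> R -> R) : iterint a b [seq F i | i <- enum 'I_0] = 1.
    by rewrite (size0nil (size_enum_ord 0)).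
  rewrite e0 (eq_bigr (fun=> 1%R)) => [|J _]; last by rewrite e0 big_ord0 mulr1.
  by rewrite sumr_const card_ffun !card_ord expn0.
pose wd := widen_ord (leqnSn N).
pose f i z := (\sum_j c i j * g i j z)%R.
have cf i t : 0 < t < 1 -> continuous (f i) t.
  move=> Ht; apply: continuous_bigsum => j.
  apply: (continuous_mult (fun=> c i j)); [exact: continuous_const | exact: cg].
pose LHS b := iterint a b [seq (fun z => f i z * density (om i) z) | i <- enum 'I_N.+1].
pose I0 (J : {ffun 'I_N -> 'I_K}) b :=
  iterint a b [seq (fun z => g (wd i) (J i) z * density (om (wd i)) z) | i <- enum 'I_N].
pose I1 (J : {ffun 'I_N.+1 -> 'I_K}) b :=
  iterint a b [seq (fun z => g i (J i) z * density (om i) z) | i <- enum 'I_N.+1].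
pose C0 (J : {ffun 'I_N -> 'I_K}) := (\prod_i c (wd i) (J i))%R.
pose RHS b := (\sum_(J : {ffun 'I_N -> 'I_K}) \sum_j (C0 J * c ord_max j) * I1 (ext_ffun J j) b)%R.
rewrite big_ext_ffun -/(LHS b); transitivity (RHS b); last first.
  apply: eq_bigr => J _; apply: eq_bigr => j _; rewrite big_ord_recr /= ext_ffun_max.
  by congr (_ * _ * _)%R; apply: eq_bigr => i _; rewrite ext_ffun_widen.
apply: (@eq_of_deriv LHS RHS
  (fun t => (\sum_(J : {ffun 'I_N -> 'I_K}) \sum_j (C0 J * c ord_max j) *
      (I0 J t * (g ord_max j t * density (om ord_max) t)))%R) a b) => //.
- move=> t Ht.
  have -> : (\sum_(J : {ffun 'I_N -> 'I_K}) \sum_j (C0 J * c ord_max j) *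
      (I0 J t * (g ord_max j t * density (om ord_max) t)))%R =
    iterint a t [seq (fun z => f i z * density (om i) z) | i <- [seq wd i | i <- enum 'I_N]]
      * (f ord_max t * density (om ord_max) t).
    have IHt := IH (fun i => c (wd i)) (fun i => g (wd i)) (fun i => om (wd i)).
    rewrite -map_comp [X in _ = X * _]IHt //; last by move=> *; exact: cg.
    rewrite !RmultE mulr_suml; apply: eq_bigr => J _; rewrite /f mulr_suml mulr_sumr.
    by apply: eq_bigr => j _; rewrite -!RmultE; eqR; rewrite -/(I0 J t) -/(C0 J); ring.
  by rewrite /LHS enum_ordSr; apply: iterint_deriv.
- move=> t Ht; apply: is_derive_bigsum => J; apply: is_derive_bigsum => j.
  have H := @iterint_deriv _ om (fun i => g i (ext_ffun J j i))
    [seq wd i | i <- enum 'I_N] ord_max a t _ Ha Ht.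
  have {H} H := H (fun i s Hs => cg _ _ _ Hs).
  move: H; rewrite -enum_ordSr -map_comp ext_ffun_max => H.
  have {H} : is_derive (I1 (ext_ffun J j)) t (I0 J t * (g ord_max j t * density (om ord_max) t)).
    move: H; congr is_derive; congr (iterint _ _ _ * _).
    by apply: eq_map => i /=; rewrite ext_ffun_widen.
  by move/(is_derive_scal _ _ (C0 J * c ord_max j)).
- rewrite /LHS map_enum_ordSr iterint_rcons RInt_point /RHS.
  rewrite big1 // => J _; rewrite big1 // => j _.
  by rewrite /I1 map_enum_ordSr iterint_rcons RInt_point mulr0.
Qed.

(** * The regularized integral *)

Lemma Plog_cont f t : Plog f -> 0 < t < 1 -> continuous f t.
Proof.
move=> Pf; elim: Pf t => [q|k|k|f1 f2 _ IH1 _ IH2|f1 f2 _ IH1 _ IH2|f1 f2 ef _ IH] t Ht.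
- exact: continuous_const.
- exact: (@gen_fun_cont (GenLi k) t Ht).
- exact: (@gen_fun_cont (GenLi1 k) t Ht).
- by apply: (continuous_plus f1); [exact: IH1 | exact: IH2].
- by apply: (continuous_mult f1); [exact: IH1 | exact: IH2].
- apply: (continuous_ext_loc _ f1); last exact: IH.
  exact: near01 Ht ef.
Qed.

Lemma mono_fun_cat m1 m2 z : mono_fun (m1 ++ m2) z = (mono_fun m1 z * mono_fun m2 z)%R.
Proof. by rewrite /mono_fun big_cat. Qed.

Lemma Plog_monomials f : Plog f -> exists l : seq (rat * monomial),
  forall z, 0 < z < 1 -> f z = (\sum_(p <- l) ratr p.1 * mono_fun p.2 z)%R.
Proof.
elim=> [q|k|k|f1 f2 _ [l1 H1] _ [l2 H2]|f1 f2 _ [l1 H1] _ [l2 H2]|f1 f2 ef _ [l H]].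
- by exists [:: (q, [::])] => z _; rewrite big_seq1 mono_fun_nil mulr1.
- by exists [:: (1%R, [:: GenLi k])] => z _; rewrite big_seq1 rmorph1 mul1r /mono_fun big_seq1.
- by exists [:: (1%R, [:: GenLi1 k])] => z _; rewrite big_seq1 rmorph1 mul1r /mono_fun big_seq1.
- by exists (l1 ++ l2) => z Hz; rewrite big_cat /= H1 // H2.
- exists [seq ((p.1 * q.1)%R, p.2 ++ q.2) | p <- l1, q <- l2] => z Hz.
  rewrite big_allpairs_dep H1 // H2 // RmultE mulr_suml; apply: eq_bigr => p _.
  rewrite mulr_sumr; apply: eq_bigr => q _.
  by rewrite rmorphM mono_fun_cat mulrACA.
- by exists l => z Hz; rewrite -ef // H.
Qed.

Section Ireg.
Variables (N : nat).
Implicit Types (f : 'I_N -> R -> R) (om : 'I_N -> form).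

Lemma Ireg_value_ex f om : (forall i, Plog (f i)) -> exists v, Ireg_value f om v.
Proof.
move=> Pf.
have [l Hl] := choice (fun i => Plog_monomials (Pf i)).
pose K := (\max_i size (l i))%N.
(* padding with zero coefficients up to a common number of terms *)
pose d : rat * monomial := (0%R, [::]).
pose c i (j : 'I_K) := (nth d (l i) j).1.
pose m i (j : 'I_K) := (nth d (l i) j).2.
eexists; exists K, c, m; split; last by [].
move=> i z Hz; rewrite Hl // (big_nth d).
rewrite -(big_mkord xpredT (fun j => ratr (nth d (l i) j).1 * mono_fun (nth d (l i) j).2 z))%R.
have sK : (size (l i) <= K)%N by apply: leq_bigmax.
have tail0 :
    (\sum_(size (l i) <= j < K) ratr (nth d (l i) j).1 * mono_fun (nth d (l i) j).2 z = 0)%R.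
  rewrite big_nat_cond big1 // => j; rewrite andbT => /andP [h _].
  by rewrite nth_default // raddf0 mul0r.
by rewrite (big_cat_nat _ sK) //= tail0 addr0.
Qed.

(** Any value given by the regularization procedure is the constant term of the expansion of the
    cut integral of the functions themselves, which does not depend on the monomials. *)
Lemma Ireg_value_log_expands f om v : Ireg_value f om v ->
  exists P, [/\ log_expands (fun e h => Icut e h f om) P, v = eval2 P 0 0 & mzv_algebra v].
Proof.
move=> [K [c [m [Hf ->]]]].
have [P HP] := choice (fun J : {ffun 'I_N -> 'I_K} => mzv_expandable_Icut (fun i => m i (J i)) om).
pose C (J : {ffun 'I_N -> 'I_K}) := (\prod_(i < N) ratr (c i (J i)) : R)%R.
have Icut_sum e h : 0 < e < / 4 -> 0 < h < / 4 -> Icut e h f om =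
    (\sum_J C J * Icut e h (fun i => mono_fun (m i (J i))) om)%R.
  move=> He Hh; rewrite /Icut.
  rewrite (iterint_ext om
    (g := fun i z => \sum_(j < K) ratr (c i j) * mono_fun (m i j) z)%R); try lra.
    apply: (iterint_multilinear (fun i j => ratr (c i j)) (g := fun i j => mono_fun (m i j)));
      try lra.
    by move=> *; exact: mono_fun_cont.
  by move=> i t Ht; rewrite Hf.
have [Q [HQ vQ zQ]] : exists Q, [/\ log_expands (fun e h =>
     (\sum_J C J * Icut e h (fun i => mono_fun (m i (J i))) om)%R) Q,
   (\sum_J C J * Ireg_mono (fun i => m i (J i)) om)%R = eval2 Q 0 0 & mzv_algebra (eval2 Q 0 0)].
  elim: (index_enum _) => [|J r [Q [HQ vQ zQ]]].
    exists ((0 : R)%:P%:P)%R; rewrite eval2C big_nil; split=> //; last exact: mzv_0.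
    by apply: log_expands_ext (log_expands_const 0) => e h _ _; rewrite big_nil.
  have [PJ zJ] := HP J.
  exists ((C J)%:P%:P * P J + Q)%R.
  rewrite big_cons vQ eval2D eval2M eval2C (Ireg_monoE PJ); split=> //.
    have CPJ := log_expands_mul (log_expands_const (C J)) PJ.
    apply: log_expands_ext (log_expands_add CPJ HQ) => e h _ _.
    by rewrite big_cons.
  apply: mzv_add zQ; apply: mzv_mul zJ; rewrite /C -rmorph_prod; exact: mzv_rat.
exists Q; rewrite vQ; split=> //.
by apply: log_expands_ext HQ => e h He Hh; rewrite Icut_sum.
Qed.

Lemma IregE f om P : (forall i, Plog (f i)) ->
  log_expands (fun e h => Icut e h f om) P -> Ireg f om = eval2 P 0 0.
Proof.
move=> Pf HP; have [v Hv] := Ireg_value_ex om Pf.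
rewrite /Ireg; case: xgetP => [w _ /Ireg_value_log_expands [Q [HQ -> _]]|H].
  by rewrite (log_expands_unique HQ HP).
by case: (H v).
Qed.

Lemma Ireg_log_expands f om : (forall i, Plog (f i)) ->
  exists P, [/\ log_expands (fun e h => Icut e h f om) P, Ireg f om = eval2 P 0 0 &
    mzv_algebra (Ireg f om)].
Proof.
move=> Pf; have [v Hv] := Ireg_value_ex om Pf.
have [P [HP vP zv]] := Ireg_value_log_expands Hv.
by exists P; rewrite (IregE Pf HP) -vP.
Qed.

(** Along each ray the cut integral tends to L, so its expansion is the constant L. *)
Lemma Ireg_convergent f om L : (forall i, Plog (f i)) ->
  Iconverges f om L -> Ireg f om = L.
Proof.
move=> Pf HL; have [P [HP -> _]] := Ireg_log_expands om Pf.
rewrite -[RHS](eval2C L 0 0); congr eval2; apply: ray_log_expands HP => c.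
apply: (is_lim_seq_ext (fun n => Icut (ray_e c n) (ray_h n) f om - L)).
  by move=> n; rewrite eval2C.
rewrite -(Rminus_diag L); apply: is_lim_seq_minus'; last exact: is_lim_seq_const.
have ray a : filterlim (fun n => exp (a - INR n.+1)) eventually (at_right 0).
  move=> Q [d Hd]; have := eventually_INR (a - ln d).
  apply: filter_imp => n Hn; have dp := cond_pos d; have ex := exp_pos (a - INR n.+1).
  apply: Hd => //; change (Rabs (exp (a - INR n.+1) - 0) < d).
  rewrite Rminus_0_r Rabs_pos_eq; last lra.
  by rewrite -[pos d]exp_ln //; apply: exp_increasing; lra.
have ray0 : filterlim ray_h eventually (at_right 0).
  apply: filterlim_ext (ray 0) => n; rewrite /ray_h; congr exp; ring.
apply: (filterlim_comp _ _ _ (fun n => (ray_e c n, ray_h n)) (fun p => Icut p.1 p.2 f om)) HL.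
by apply: filterlim_pair ray0; exact: ray.
Qed.
End Ireg.

(** Both sides are constant terms of expansions of the same function of the cut-offs. *)
Lemma Ireg_shuffle N M (f : 'I_(N + M) -> R -> R) (om : 'I_(N + M) -> form) :
  (forall i, Plog (f i)) ->
  (Ireg (fun i : 'I_N => f (lshift M i)) (fun i => om (lshift M i))
   * Ireg (fun i : 'I_M => f (rshift N i)) (fun i => om (rshift N i))
   = \sum_(s : {perm 'I_(N + M)} | is_shuffle s)
       Ireg (fun i => f ((s^-1)%g i)) (fun i => om ((s^-1)%g i)))%R.
Proof.
move=> Pf.
pose phi i := Cfun (letter_cont (w := om i) (fun t => Plog_cont (t := t) (Pf i))).
have Icut_itr n (p : 'I_n -> 'I_(N + M)) e h :
  Icut e h (fun i => f (p i)) (fun i => om (p i)) =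
  itr e (map phi (rev (map p (enum 'I_n)))) (1 - h).
  by rewrite map_rev -iterint_itr -(map_comp phi p) -(map_comp cf).
have [P [HP -> _]] :=
  Ireg_log_expands (fun i : 'I_N => om (lshift M i)) (fun i : 'I_N => Pf (lshift M i)).
have [Q [HQ -> _]] :=
  Ireg_log_expands (fun i : 'I_M => om (rshift N i)) (fun i : 'I_M => Pf (rshift N i)).
have Pfs (s : {perm 'I_(N + M)}) i : Plog (f ((s^-1)%g i)) by exact: Pf.
have [T HT] := choice (fun s : {perm 'I_(N + M)} =>
  Ireg_log_expands (fun i => om ((s^-1)%g i)) (Pfs s)).
rewrite -RmultE -eval2M.
have -> : (\sum_(s : {perm 'I_(N + M)} | is_shuffle s)
    Ireg (fun i => f ((s^-1)%g i)) (fun i => om ((s^-1)%g i)))%R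
   = eval2 (\sum_(s : {perm 'I_(N + M)} | is_shuffle s) T s)%R 0 0.
  rewrite /eval2 !horner_sum; apply: eq_bigr => s _.
  by have [_ -> _] := HT s.
congr eval2; apply: log_expands_unique (log_expands_mul HP HQ) _.
apply: (@log_expands_ext (fun e h => (\sum_(s : {perm 'I_(N + M)} | is_shuffle s)
   Icut e h (fun i => f ((s^-1)%g i)) (fun i => om ((s^-1)%g i)))%R)).
  move=> e h He Hh; rewrite !Icut_itr itr_shuffle; try lra.
  rewrite sumR_big (perm_big _ (shuffle_perms N M)) big_map big_enum /=.
  by apply: eq_bigr => s _; rewrite Icut_itr.
elim: (index_enum _) => [|s r IH].
  rewrite big_nil; apply: log_expands_ext (log_expands_const 0) => e h _ _; by rewrite big_nil.
rewrite big_cons; case: ifP => Hs; last first.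
  by apply: log_expands_ext IH => e h _ _; rewrite big_cons Hs.
have [Ts _ _] := HT s.
by apply: log_expands_ext (log_expands_add Ts IH) => e h _ _; rewrite big_cons Hs.
Qed.

Theorem theorem1p3 :
  (forall (N : nat) (m : 'I_N -> monomial) (om : 'I_N -> form),
     (0 < N)%N -> exists! P : {poly {poly R}}, log_expansion m om P) /\
  (forall (N : nat) (f : 'I_N -> R -> R) (om : 'I_N -> form),
     (0 < N)%N -> (forall i, Plog (f i)) ->
     exists! v : R, Ireg_value f om v) /\
  (forall (N M : nat) (f : 'I_(N + M) -> R -> R) (om : 'I_(N + M) -> form),
     (0 < N)%N -> (0 < M)%N -> (forall i, Plog (f i)) ->
     (Ireg (fun i : 'I_N => f (lshift M i)) (fun i => om (lshift M i))
      * Ireg (fun i : 'I_M => f (rshift N i)) (fun i => om (rshift N i))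
      = \sum_(s : {perm 'I_(N + M)} | is_shuffle s)
          Ireg (fun i => f ((s^-1)%g i)) (fun i => om ((s^-1)%g i)))%R) /\
  (forall (N : nat) (f : 'I_N -> R -> R) (om : 'I_N -> form) (L : R),
     (0 < N)%N -> (forall i, Plog (f i)) ->
     Iconverges f om L -> Ireg f om = L) /\
  (forall (N : nat) (f : 'I_N -> R -> R) (om : 'I_N -> form),
     (0 < N)%N -> (forall i, Plog (f i)) -> mzv_algebra (Ireg f om)).
Proof.
split; first move=> N m om _.
  have [P [HP _]] := mzv_expandable_Icut_mono m om.
  by exists P; exact: log_expansionP.
split; first move=> N f om _ Pf.
  have [v Hv] := Ireg_value_ex om Pf; exists v; split=> // w Hw.
  have [P [HP -> _]] := Ireg_value_log_expands Hv; have [Q [HQ -> _]] := Ireg_value_log_expands Hw.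
  by rewrite (log_expands_unique HP HQ).
split; first by move=> N M f om _ _; exact: Ireg_shuffle.
split; first by move=> N f om L _; exact: Ireg_convergent.
by move=> N f om _ Pf; have [P []] := Ireg_log_expands om Pf.
Qed.
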